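(* Let $n\ge2$, $T=\{1,\dots,n\}$, $S=\emptyset$, and let $sl(n,\mathbb C)$ act on $\mathcal B=\mathbb C[x_1,\dots,x_n,y_1,\dots,y_n]$ by $E_{i,j}|_{\mathcal B}=-x_j\partial_{x_i}-\delta_{i,j}-y_j\partial_{y_i}$. Let $\Delta=-\sum_{i=1}^nx_i\partial_{y_i}$, $\eta=\sum_{i=1}^ny_i\partial_{x_i}$, $u_{n-1}=x_{n-1}y_n-x_ny_{n-1}$, and for integers $l_1\le0$, $l_2\ge0$ let $\mathcal H_{l_1,l_2}=\{f\in\mathcal B_{l_1,l_2}\mid\Delta(f)=0\}$ and $\mathcal H'_{l_1,l_2}=\{f\in\mathcal B_{l_1,l_2}\mid\eta(f)=0\}$. If $l_1+l_2\le0$, then $\mathcal B_{l_1,l_2}=\mathcal H_{l_1,l_2}\oplus\eta\mathcal B_{l_1-1,l_2-1}$, and $\mathcal H_{l_1,l_2}$ is an irreducible highest weight module with highest weight $l_2\lambda_{n-2}-(l_1+l_2)\lambda_{n-1}$, a corresponding highest weight vector $x_n^{-l_1-l_2}u_{n-1}^{l_2}$, and basis $$\Big\{\prod_{t=1}^nx_t^{k_t}\prod_{1\le i<j\le n}(x_iy_j-x_jy_i)^{k_{i,j}}\ \Big|\ k_t,k_{i,j}\in\mathbb N;\ \sum k_{i,j}=l_2,\ \sum k_t=-l_1-l_2;\ k_{i,j}k_t=0\text{ for }i<j<t;\ k_{i,j}k_{i_1,j_1}=0\text{ for }i<i_1\text{ and }j>j_1\Big\}.$$ If $l_1+l_2>0$,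 then $\mathcal B_{l_1,l_2}=\mathcal H'_{l_1,l_2}\oplus\Delta\mathcal B_{l_1+1,l_2+1}$, and $\mathcal H'_{l_1,l_2}$ is an irreducible highest weight module with highest weight $-l_1\lambda_{n-2}+(l_1+l_2)\lambda_{n-1}$ and a corresponding highest weight vector $y_n^{l_1+l_2}u_{n-1}^{-l_1}$. The set $$\Big\{\prod_{t=1}^ny_t^{k_t}\prod_{1\le i<j\le n}(x_iy_j-x_jy_i)^{k_{i,j}}\ \Big|\ k_t,k_{i,j}\in\mathbb N;\ \sum k_{i,j}=-l_1,\ \sum k_t=l_1+l_2;\ k_{i,j}k_t=0\text{ for }i<j<t;\ k_{i,j}k_{i_1,j_1}=0\text{ for }i<i_1\text{ and }j>j_1\Big\}$$ forms a basis of $\mathcal H'_{l_1,l_2}$.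
   Context: $\mathbb N$ denotes the nonnegative integers; $E_{i,j}$ are matrix units of size $n$. $sl(n,\mathbb C)$ has Cartan subalgebra $H=\sum_{i=1}^{n-1}\mathbb C(E_{i,i}-E_{i+1,i+1})$, positive root vectors $E_{i,j}$ ($1\le i<j\le n$) spanning $\mathcal G_+$, and fundamental weights $\lambda_i$ with $\lambda_i(E_{j,j}-E_{j+1,j+1})=\delta_{i,j}$; $\lambda_0=0$. $\mathcal B_{l_1,l_2}=\mathrm{Span}\{x^\alpha y^\beta\mid |\alpha|=-l_1,\ |\beta|=l_2\}$, and it is $\{0\}$ if $l_1>0$ or $l_2<0$. The operators $\Delta$ and $\eta$ commute with $sl(n,\mathbb C)$. A highest weight module is one generated by a nonzero $v$ with $H.v\subset\mathbb Cv$ and $\mathcal G_+.v=0$ (a highest weight vector), whose weight is the highest weight. *)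

(* Defs.v *)
From HB Require Import structures.
From mathcomp Require Import all_boot all_order all_algebra.
From mathcomp Require Import reals complex mpoly.

Set Implicit Arguments.
Unset Strict Implicit.
Unset Printing Implicit Defensive.

Import Order.TTheory GRing.Theory Num.Theory.
Local Open Scope ring_scope.

(* The spaces involved are infinite-dimensional, hence subspaces are predicates
   and not elements of {vspace V}. *)
Section LinearAlgebra.
Variables (F : fieldType) (V : lmodType F).
Implicit Types (S M N : V -> Prop).

Definition subspace M : Prop :=
  M 0 /\ forall (a : F) (u v : V), M u -> M v -> M (a *: u + v).

Definition lin_span S (v : V) : Prop :=
  exists (s : seq V) (c : V -> F),
    (forall u, u \in s -> S u) /\ v = \sum_(u <- s) c u *: u.

Definition lin_indep S : Prop :=
  forall (s : seq V) (c : V -> F), uniq s -> (forall u, u \in s -> S u) ->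
    \sum_(u <- s) c u *: u = 0 -> forall u, u \in s -> c u = 0.

Definition is_basis S M : Prop :=
  lin_indep S /\ forall v, M v <-> lin_span S v.

Definition im_of (f : V -> V) M (w : V) : Prop := exists2 v, M v & w = f v.

Definition is_direct_sum M N1 N2 : Prop :=
  [/\ subspace N1, subspace N2,
      forall v, M v <-> exists u w, [/\ N1 u, N2 w & v = u + w]
    & forall v, N1 v -> N2 v -> v = 0].

End LinearAlgebra.

Section SpecialLinear.
Variables (F : fieldType) (n : nat).

Definition sl (A : 'M[F]_n) : Prop := \tr A = 0.

(* E_{k,k} - E_{k+1,k+1} for 1 <= k <= n-1, where k counts rows from 1 while
   the ordinals i : 'I_n count from 0. *)
Definition coroot (k : nat) : 'M[F]_n :=
  diag_mx (\row_(i < n) ((i.+1 == k)%:R - (i == k :> nat)%:R)).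

Definition coroots : (n.-1).-tuple 'M[F]_n := [tuple coroot k.+1 | k < n.-1].

Definition cartan : {vspace 'M[F]_n} := <<coroots>>%VS.

(* the span of the positive root vectors *)
Definition pos_nilp : {vspace 'M[F]_n} :=
  (\sum_(i < n) \sum_(j < n | (i < j)%N) <[delta_mx i j]>)%VS.

(* The basis of the dual of [cartan] that is dual to [coroots], numbered from
   1, and [fweight 0] = 0.  Weights are functions on all matrices, but only
   their restriction to [cartan] is meaningful. *)
Definition fweight (i : nat) (h : 'M[F]_n) : F :=
  \sum_(k < n.-1 | k.+1 == i) coord coroots k h.

Lemma coroots_free : free coroots.
Proof.
apply/freeP => c Hc.
have E (a : 'I_n) :
    \sum_(k < n.-1) c k * ((a == k :> nat)%:R - (a == k.+1 :> nat)%:R) = 0.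
  have := congr1 (fun M : 'M_n => M a a) Hc.
  rewrite summxE [RHS]mxE => E0; rewrite -[RHS]E0; apply: eq_bigr => k _.
  by rewrite (nth_mktuple (fun k : 'I_n.-1 => coroot k.+1)) !mxE eqxx mulr1n eqSS.
suff H m (Hm : (m < n.-1)%N) : c (Ordinal Hm) = 0 by case=> m Hm; exact: H.
elim/ltn_ind: m Hm => m IH Hm.
have mn : (m < n)%N by apply: leq_trans Hm (leq_pred n).
have := E (Ordinal mn).
rewrite (bigD1 (Ordinal Hm)) //= eqxx (ltn_eqF (ltnSn m)) subr0 mulr1.
rewrite big1 ?addr0 // => -[k Hk] /eqP nek /=.
have [mk|_] := eqVneq m k; first by case: nek; apply: val_inj.
have [mk|_] := eqVneq m k.+1; last by rewrite subr0 mulr0.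
by rewrite IH ?mul0r // mk.
Qed.

Lemma fweight_coroot (i k : nat) : (0 < k < n)%N ->
  fweight i (coroot k) = (i == k)%:R.
Proof.
move=> /andP[k_gt0 kn]; have Hk : (k.-1 < n.-1)%N by case: k n k_gt0 kn => [|k] [].
have -> : coroot k = coroots`_(Ordinal Hk).
  by rewrite (nth_mktuple (fun k : 'I_n.-1 => coroot k.+1)) /= prednK.
rewrite /fweight; under eq_bigr => j _ do rewrite coord_free ?coroots_free //.
have [->|ik] := eqVneq i k.
  rewrite (bigD1 (Ordinal Hk)) /= ?prednK ?eqxx // big1 ?addr0 //.
  by move=> j /andP[_ nj]; rewrite eq_sym (negbTE nj).
rewrite big1 // => j /eqP ji; case: eqP => //= jk; case/eqP: ik.
by rewrite -ji -jk /= prednK.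
Qed.

Section Action.
Variables (V : lmodType F) (act : 'M[F]_n -> V -> V).
Implicit Types (M N : V -> Prop) (mu : 'M[F]_n -> F).

Definition submodule M : Prop :=
  subspace M /\ forall A v, sl A -> M v -> M (act A v).

Definition irreducible_module M : Prop :=
  [/\ submodule M, exists2 v, M v & v <> 0
    & forall N, submodule N -> (forall v, N v -> M v) ->
        (forall v, N v -> v = 0) \/ (forall v, M v -> N v)].

Definition generated_by M (v : V) : Prop :=
  M v /\ forall N, submodule N -> N v -> forall w, M w -> N w.

Definition highest_weight_vector mu (v : V) : Prop :=
  [/\ v <> 0, forall h, h \in cartan -> act h v = mu h *: v
    & forall e, e \in pos_nilp -> act e v = 0].

Definition highest_weight_module M mu (v : V) : Prop :=
  [/\ submodule M, generated_by M v & highest_weight_vector mu v].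

End Action.
End SpecialLinear.

Section Polynomials.
Variables (R : realType) (n : nat).

Local Notation C := R[i].
Local Notation B := {mpoly C[n + n]}.

Definition xvar (i : 'I_n) : B := 'X_(lshift n i).
Definition yvar (i : 'I_n) : B := 'X_(rshift n i).
Definition dx (i : 'I_n) (f : B) : B := f^`M(lshift n i).
Definition dy (i : 'I_n) (f : B) : B := f^`M(rshift n i).

Definition Eact (i j : 'I_n) (f : B) : B :=
  - (xvar j * dx i f) - (i == j)%:R * f - yvar j * dy i f.

(* the linear extension of [Eact] to all matrices *)
Definition mxact (A : 'M[C]_n) (f : B) : B :=
  \sum_(i < n) \sum_(j < n) A i j *: Eact i j f.

Definition DeltaB (f : B) : B := - \sum_(i < n) xvar i * dy i f.
Definition etaB (f : B) : B := \sum_(i < n) yvar i * dx i f.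

Definition minor (i j : 'I_n) : B := xvar i * yvar j - xvar j * yvar i.

(* |alpha| is a natural number, so this is {0} when 0 < l1 or l2 < 0. *)
Definition Bhom (l1 l2 : int) : B -> Prop :=
  lin_span (fun f : B => exists alpha beta : 'I_n -> nat,
    [/\ (\sum_(i < n) alpha i)%N%:Z = - l1, (\sum_(i < n) beta i)%N%:Z = l2
      & f = \prod_(i < n) xvar i ^+ alpha i * \prod_(i < n) yvar i ^+ beta i]).

Definition Hhom (l1 l2 : int) (f : B) : Prop := Bhom l1 l2 f /\ DeltaB f = 0.
Definition Hhom' (l1 l2 : int) (f : B) : Prop := Bhom l1 l2 f /\ etaB f = 0.

(* The products of the variables [z t] and the minors, with total exponent [a]
   in the former and [b] in the latter; only [kk i j] with i < j matters. *)
Definition standard_product (z : 'I_n -> B) (a b : int) (f : B) : Prop :=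
  exists (k : 'I_n -> nat) (kk : 'I_n -> 'I_n -> nat),
    [/\ (\sum_(i < n) \sum_(j < n | (i < j)%N) kk i j)%N%:Z = b,
        (\sum_(t < n) k t)%N%:Z = a,
        forall i j t : 'I_n, (i < j)%N -> (j < t)%N -> (kk i j * k t)%N = 0%N,
        forall i j i1 j1 : 'I_n, (i < j)%N -> (i1 < j1)%N ->
          (i < i1)%N -> (j1 < j)%N -> (kk i j * kk i1 j1)%N = 0%N
      & f = \prod_(t < n) z t ^+ k t *
            \prod_(i < n) \prod_(j < n | (i < j)%N) minor i j ^+ kk i j].

End Polynomials.

Fact ord_n_subproof (n : nat) : (1 < n)%N -> (n.-1 < n)%N.
Proof. by case: n. Qed.

Fact ord_n1_subproof (n : nat) : (1 < n)%N -> (n.-2 < n)%N.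
Proof. by case: n => [|[]]. Qed.

(* the indices n and n-1, counted from 1 *)
Definition ord_n (n : nat) (hn : (1 < n)%N) : 'I_n :=
  Ordinal (ord_n_subproof hn).
Definition ord_n1 (n : nat) (hn : (1 < n)%N) : 'I_n :=
  Ordinal (ord_n1_subproof hn).

(* Main.v *)
Require Import Defs.
From HB Require Import structures.
From mathcomp Require Import all_boot all_order all_algebra.
From mathcomp Require Import boolp reals complex ssrcomplements mpoly ring zify.

Set Implicit Arguments.
Unset Strict Implicit.
Unset Printing Implicit Defensive.

Import Order.TTheory GRing.Theory Num.Theory.
Local Open Scope ring_scope.

(* The Hermitian form <f, g> = sum_m m! f_m conj(g_m) makes Delta and eta adjoint
   up to sign, and E_ij adjoint to E_ji; so the direct sum is an orthogonal
   decomposition, and the orthogonal complement of a submodule is a submodule.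
   A nonzero submodule contains a vector killed by the positive root vectors, and in
   the kernel such a vector is determined by a single coefficient; two orthogonal
   submodules cannot share it, whence irreducibility.  The span of all products of
   variables and minors is a submodule, hence the whole kernel, and is straightened
   by Pluecker relations.  Standard products are independent because they have
   distinct leading monomials.  The second case is the first one with the roles of
   the x_i and the y_i exchanged. *)

(** Both cases come from one argument in which the variables are given by two embeddings [a] and [b]
    of ['I_n], with disjoint images that cover all indices. For [a], [b] the x and the y the space
    studied is the kernel of $\Delta$; for the opposite choice it is the kernel of $\eta$. The
    exchange negates $x_iy_j-x_jy_i$, whence a nonzero scalar [eps], equal to $1$ or $-1$. A product
    of $k$ variables and $l$ minors has bidegree $(k+l,l)$, so each kernel is parametrized by two
    natural numbers $k$ and $l$; the sign of $l_1+l_2$ tells in which of the two kernels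
    $k=|l_1+l_2|$ fits. The ambient space has infinite dimension. What replaces finite dimension is
    that a bidegree admits finitely many monomials: hence orthogonal projections exist, and raising
    a vector repeatedly comes to an end. The coefficient that determines a highest vector is that of
    $x_n^{k+l}y_{n-1}^l$, the leading monomial of $x_n^ku_{n-1}^l$. *)

Section Subspaces.
Variables (F : fieldType) (V : lmodType F).
Implicit Types (S M N : V -> Prop).

Lemma subspaceZ M : subspace M -> forall c v, M v -> M (c *: v).
Proof. by move=> [M0 ML] c v Mv; rewrite -[_ *: _]addr0; exact: ML. Qed.

Lemma subspaceD M : subspace M -> forall u v, M u -> M v -> M (u + v).
Proof. by move=> [_ ML] u v Mu Mv; rewrite -[u]scale1r; exact: ML. Qed.

Lemma subspaceN M : subspace M -> forall v, M v -> M (- v).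
Proof. by move=> sM v Mv; rewrite -scaleN1r; exact: subspaceZ. Qed.

Lemma subspaceB M : subspace M -> forall u v, M u -> M v -> M (u - v).
Proof. by move=> sM u v Mu Mv; apply: subspaceD => //; apply: subspaceN. Qed.

Lemma subspace_sum M : subspace M ->
  forall (I : Type) (r : seq I) (P : pred I) (G : I -> V),
  (forall i, P i -> M (G i)) -> M (\sum_(i <- r | P i) G i).
Proof.
move=> sM I r P G MG; elim/big_ind: _ => //; first by case: sM.
exact: subspaceD.
Qed.

(** [lin_span] attaches one coefficient to each vector, so when lists are concatenated the
    coefficients of a repeated vector have to be added up. *)
Lemma lin_span_pairs S (s : seq (F * V)) :
  (forall p, p \in s -> S p.2) -> lin_span S (\sum_(p <- s) p.1 *: p.2).
Proof.
move=> sS; exists (undup (unzip2 s)), (fun u => \sum_(p <- s | p.2 == u) p.1).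
split=> [u|]; first by rewrite mem_undup => /mapP[p ps ->]; exact: sS.
under [RHS]eq_bigr => u _ do rewrite scaler_suml.
rewrite (exchange_big_dep xpredT) //= !big_seq; apply: eq_bigr => p ps.
rewrite -big_filter.
rewrite (_ : filter _ _ = [:: p.2]) ?big_seq1 //.
have us := undup_uniq (unzip2 s).
have pu : p.2 \in undup (unzip2 s) by rewrite mem_undup map_f.
by apply/perm_small_eq => //; apply: uniq_perm; rewrite ?filter_uniq // => u;
  rewrite mem_filter inE eq_sym; case: eqP => // ->.
Qed.

Lemma lin_span_subspace S : subspace (lin_span S).
Proof.
split=> [|c u v [s [f [sS ->]]] [t [g [tS ->]]]].
  by exists [::], (fun=> 0); split=> //; rewrite big_nil.
have -> : c *: (\sum_(u <- s) f u *: u) + \sum_(u <- t) g u *: u =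
    \sum_(p <- [seq (c * f u, u) | u <- s] ++ [seq (g u, u) | u <- t])
      p.1 *: p.2.
  rewrite big_cat !big_map scaler_sumr; congr (_ + _).
  by apply: eq_bigr => w _; rewrite scalerA.
apply: lin_span_pairs => p; rewrite mem_cat => /orP[] /mapP[w wi ->] /=.
  exact: sS.
exact: tS.
Qed.

Lemma lin_span_incl S v : S v -> lin_span S v.
Proof.
move=> Sv; exists [:: v], (fun=> 1).
by split=> [u|]; [rewrite inE => /eqP -> | rewrite big_seq1 scale1r].
Qed.

Lemma lin_span_min S M :
  subspace M -> (forall v, S v -> M v) -> forall v, lin_span S v -> M v.
Proof.
move=> sM SM v [s [f [sS ->]]]; rewrite big_seq; apply: (subspace_sum sM) => u us.
by apply: subspaceZ => //; apply/SM/sS.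
Qed.

End Subspaces.

(** * Finite multisets and families of exponents *)

Lemma seq_argmax (T : eqType) (h : T -> nat) (s : seq T) :
  s <> [::] -> exists2 x, x \in s & forall y, y \in s -> (h y <= h x)%N.
Proof.
elim: s => // x s IH _; have [->|/eqP/IH [y ys yM]] := eqVneq s [::].
  by exists x; rewrite ?inE // => y; rewrite inE => /eqP ->.
have [hxy|/ltnW hyx] := leqP (h x) (h y).
  by exists y; rewrite ?inE ?ys ?orbT // => z; rewrite inE => /orP[/eqP ->|/yM].
exists x; rewrite ?inE ?eqxx // => z; rewrite inE => /orP[/eqP ->//|/yM zy].
exact: leq_trans zy hyx.
Qed.

(* A multiset of pairs without nesting is sorted in both components at once,
   hence is determined by its two marginals. *)
Lemma nonnested_perm (T : eqType) (f g : T -> nat) (s t : seq T) :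
  injective (fun c => (f c, g c)) ->
  {in s &, forall c d, ~~ ((f c < f d)%N && (g d < g c)%N)} ->
  {in t &, forall c d, ~~ ((f c < f d)%N && (g d < g c)%N)} ->
  perm_eq (map f s) (map f t) -> perm_eq (map g s) (map g t) ->
  perm_eq s t.
Proof.
move=> fg_inj.
pose le c d := (f c < f d)%N || (f c == f d) && (g c <= g d)%N.
have le_tot : total le.
  by move=> c d; rewrite /le; case: ltngtP => //= _; apply: leq_total.
have sorted_fg (u : seq T) : {in u &, forall c d, ~~ ((f c < f d)%N && (g d < g c)%N)} ->
    sorted leq (map f (sort le u)) /\ sorted leq (map g (sort le u)).
  move=> unn; have us := sort_sorted le_tot u.
  have uin : {subset sort le u <= u} by move=> c; rewrite mem_sort.
  rewrite !sorted_map; split;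
    apply: (sub_in_sorted (P := mem (sort le u))) (us) => [c d cu du|]; try exact/allP.
    - by case/orP => [/ltnW//|/andP[/eqP/= -> _]]; apply: leqnn.
  - case/orP => [cd|/andP[_]//]; have := unn c d (uin c cu) (uin d du).
  by rewrite cd /= -leqNgt.
move=> /sorted_fg[sf sg] /sorted_fg[tf tg] fst gst.
have permE (h : T -> nat) : perm_eq (map h s) (map h t) ->
    perm_eq (map h (sort le s)) (map h (sort le t)).
  move=> P; apply: perm_trans (perm_trans P _); first by apply: perm_map; rewrite perm_sort.
  by apply: perm_map; rewrite perm_sym perm_sort.
have fE := sorted_eq leq_trans anti_leq sf tf (permE f fst).
have gE := sorted_eq leq_trans anti_leq sg tg (permE g gst).
have : sort le s = sort le t.
  apply: (inj_map fg_inj).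
  have zipE (u : seq T) : [seq (f c, g c) | c <- u] = zip (map f u) (map g u).
    by elim: u => //= c u ->.
  by rewrite !zipE fE gE.
by move=> E; rewrite -(perm_sort le s) E perm_sort.
Qed.

Lemma big_option_pair (R : Type) (idx : R) (op : Monoid.com_law idx)
    (I J : finType) (H : option I * J -> R) :
  \big[op/idx]_c H c =
  op (\big[op/idx]_j H (None, j)) (\big[op/idx]_i \big[op/idx]_j H (Some i, j)).
Proof.
transitivity (\big[op/idx]_o \big[op/idx]_j H (o, j)).
  by rewrite pair_bigA; apply: eq_bigr => -[].
rewrite (bigD1 None) //=; congr (op _ _).
rewrite (reindex_omap Some id) /=; last by case.
by apply: eq_bigl => i; rewrite eqxx.
Qed.

Lemma prodr_count (R : comPzRingType) (T : finType) (F : T -> R) (s : seq T) :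
  \prod_(c <- s) F c = \prod_c F c ^+ count_mem c s.
Proof.
elim: s => [|x s IH]; first by rewrite big_nil big1.
rewrite big_cons IH /=; under [RHS]eq_bigr => c _ do rewrite exprD.
rewrite big_split; congr (_ * _); rewrite (bigD1 x) //= eqxx expr1 big1 ?mulr1 //.
by move=> c; rewrite eq_sym => /negbTE ->.
Qed.

Lemma sum_count (T : finType) (p : pred T) (s : seq T) :
  count p s = (\sum_c p c * count_mem c s)%N.
Proof.
elim: s => [|x s IH]; first by rewrite big1 // => c _; rewrite muln0.
rewrite /= IH; under [RHS]eq_bigr => c _ do rewrite mulnDr.
rewrite big_split; congr (_ + _)%N; rewrite (bigD1 x) //= eqxx muln1 big1 ?addn0 //.
by move=> c; rewrite eq_sym => /negbTE ->; rewrite muln0.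
Qed.

(** Passes from exponents to a list of factors: the proof treats products as lists of generators,
    while the theorem speaks of exponents. *)
Lemma exists_count_mem (T : finType) (K : T -> nat) :
  exists s : seq T, forall c, count_mem c s = K c.
Proof.
exists (flatten [seq nseq (K c) c | c <- enum T]) => c.
rewrite count_flatten -map_comp sumnE big_map big_enum (bigD1 c) //=.
rewrite count_nseq /= eqxx mul1n big1 ?addn0 // => d /negbTE dc.
by rewrite count_nseq /= dc.
Qed.

(** * The Fischer inner product on polynomials *)

Section FischerForm.
Variables (C : numClosedFieldType) (N : nat).
Local Notation B := {mpoly C[N]}.
Implicit Types (f g h : B) (m : 'X_{1..N}) (S : B -> Prop).

Definition mnm_fact m : nat := (\prod_(i < N) (m i)`!)%N.

Definition fischer f g : C :=
  \sum_(m <- msupp f) (mnm_fact m)%:R * f@_m * (g@_m)^*.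

Lemma mnm_fact_gt0 m : (0 < mnm_fact m)%N.
Proof. by apply: prodn_gt0 => i; exact: fact_gt0. Qed.

(** The factor [(m i).+1] is the one that differentiation by ['X_i] produces; this is why the form
    is weighted by factorials. *)
Lemma mnm_factS m i : mnm_fact (m + U_(i))%MM = ((m i).+1 * mnm_fact m)%N.
Proof.
rewrite /mnm_fact (bigD1 i) //= [in RHS](bigD1 i) //= mnmDE mnm1E eqxx addn1.
rewrite factS mulnA; congr (_ * _)%N; apply: eq_bigr => j /negbTE ji.
by rewrite mnmDE mnm1E eq_sym ji addn0.
Qed.

(** The support of [f] varies with [f]; a common degree bound gives several polynomials the same
    index set, as additivity and symmetry require. *)
Lemma fischerE k f g : (msize f <= k)%N ->
  fischer f g = \sum_(m : 'X_{1..N < k}) (mnm_fact m)%:R * f@_m * (g@_m)^*.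
Proof.
move=> fk; rewrite /fischer.
pose I : subFinType _ := 'X_{1..N < k}.
rewrite (big_mksub I) /=; first last.
- by move=> m /msize_mdeg_lt /leq_trans; exact.
- exact: msupp_uniq.
rewrite [RHS](bigID (fun m : 'X_{1..N < k} => val m \in msupp f)) /=.
rewrite [X in _ + X]big1 ?addr0 // => m mf.
by rewrite memN_msupp_eq0 // mulr0 mul0r.
Qed.

Lemma fischerC f g : fischer f g = (fischer g f)^*.
Proof.
pose k := maxn (msize f) (msize g).
rewrite (@fischerE k) ?leq_maxl // (@fischerE k g) ?leq_maxr //.
rewrite rmorph_sum; apply: eq_bigr => m _.
by rewrite !rmorphM /= conjCK conjC_nat mulrAC.
Qed.

Lemma fischerPl c f g h : fischer (c *: f + g) h = c * fischer f h + fischer g h.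
Proof.
pose k := maxn (msize (c *: f + g)) (maxn (msize f) (msize g)).
have fk : (msize f <= k)%N by rewrite !leq_max leqnn orbT.
have gk : (msize g <= k)%N by rewrite !leq_max leqnn !orbT.
rewrite (@fischerE k) ?leq_maxl // (@fischerE k f h fk) (@fischerE k g h gk).
rewrite mulr_sumr -big_split; apply: eq_bigr => m _ /=.
rewrite mcoeffD mcoeffZ; ring.
Qed.

Lemma fischer0l f : fischer 0 f = 0.
Proof. by rewrite /fischer msupp0 big_nil. Qed.

Lemma fischerDl f g h : fischer (f + g) h = fischer f h + fischer g h.
Proof. by rewrite -{1}[f]scale1r fischerPl mul1r. Qed.

Lemma fischerZl c f h : fischer (c *: f) h = c * fischer f h.
Proof. by rewrite -[c *: f]addr0 fischerPl fischer0l addr0. Qed.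

Lemma fischerBl f g h : fischer (f - g) h = fischer f h - fischer g h.
Proof. by rewrite fischerDl -scaleN1r fischerZl mulN1r. Qed.

Lemma fischerPr c f g h :
  fischer h (c *: f + g) = c^* * fischer h f + fischer h g.
Proof. by rewrite fischerC fischerPl rmorphD rmorphM /= -!fischerC. Qed.

Lemma fischer0r f : fischer f 0 = 0.
Proof. by rewrite fischerC fischer0l rmorph0. Qed.

Lemma fischerDr f g h : fischer h (f + g) = fischer h f + fischer h g.
Proof. by rewrite -{1}[f]scale1r fischerPr rmorph1 mul1r. Qed.

Lemma fischerZr c f h : fischer h (c *: f) = c^* * fischer h f.
Proof. by rewrite -[c *: f]addr0 fischerPr fischer0r addr0. Qed.

Lemma fischerNl f h : fischer (- f) h = - fischer f h.
Proof. by rewrite -scaleN1r fischerZl mulN1r. Qed.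

Lemma fischerNr f h : fischer h (- f) = - fischer h f.
Proof. by rewrite -scaleN1r fischerZr rmorphN rmorph1 mulN1r. Qed.

Lemma fischer_suml (I : Type) (r : seq I) (P : pred I) (G : I -> B) h :
  fischer (\sum_(i <- r | P i) G i) h = \sum_(i <- r | P i) fischer (G i) h.
Proof.
by apply: (big_morph (fun f => fischer f h)) => [f g|];
  rewrite ?fischerDl ?fischer0l.
Qed.

Lemma fischer_sumr (I : Type) (r : seq I) (P : pred I) (G : I -> B) h :
  fischer h (\sum_(i <- r | P i) G i) = \sum_(i <- r | P i) fischer h (G i).
Proof.
by apply: (big_morph (fun f => fischer h f)) => [f g|];
  rewrite ?fischerDr ?fischer0r.
Qed.

Lemma fischer_eq0 f : fischer f f = 0 -> f = 0.
Proof.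
move=> /eqP; rewrite /fischer big_seq psumr_eq0 => [/allP f0|m _]; last first.
  by rewrite -mulrA mulr_ge0 ?ler0n // mul_conjC_ge0.
apply/eqP; rewrite -msupp_eq0; apply: contraT.
case E: (msupp f) => [//|m s] _.
have mf : m \in msupp f by rewrite E inE eqxx.
have := f0 _ mf; rewrite mf -mulrA mulf_eq0 pnatr_eq0 -leqn0 leqNgt.
by rewrite mnm_fact_gt0 mul_conjC_eq0 mcoeff_eq0 mf.
Qed.

Lemma fischer_mulX i f g : fischer ('X_i * f) g = fischer f (g^`M(i)).
Proof.
elim/mpolyind: f => [|c m f _ _ IH]; first by rewrite mulr0 !fischer0l.
rewrite mulrDr -scalerAr !fischerPl IH -mpolyXD; congr (_ * _ + _).
rewrite /fischer !msuppX !big_seq1 !mcoeffX !eqxx mcoeff_deriv addmC mnm_factS.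
by rewrite rmorphMn /= natrM -!mulrA !mul1r mulrCA; congr (_ * _); rewrite mulr_natl.
Qed.

Definition xd (k l : 'I_N) f : B := 'X_k * f^`M(l).

Lemma fischer_xd k l f g : fischer (xd k l f) g = fischer f (xd l k g).
Proof.
by rewrite fischer_mulX fischerC -fischer_mulX -fischerC.
Qed.

(* Gram-Schmidt, by induction on the set of allowed monomials. *)
Lemma fischer_projection (s : seq 'X_{1..N}) S :
  subspace S -> (forall f, S f -> {subset msupp f <= s}) ->
  forall f, exists2 u, S u & forall g, S g -> fischer (f - u) g = 0.
Proof.
elim: s S => [|m s IH] S sS Ss f.
  exists 0 => [|g /Ss gs]; first by case: sS.
  suff -> : g = 0 by rewrite fischer0r.
  by apply: msuppnil0; case: msupp gs => // m s /(_ m); rewrite inE eqxx => /(_ isT).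
(* The subspace of [S] whose elements avoid [m] is covered by the induction hypothesis, and has
   codimension at most one in [S]. *)
pose S' g := S g /\ g@_m = 0.
have sS' : subspace S'.
  split=> [|c u v [Su um] [Sv vm]]; split; first by case: sS.
  - by rewrite mcoeff0.
  - by case: sS => _; apply.
  - by rewrite mcoeffD mcoeffZ um vm mulr0 addr0.
have S's g : S' g -> {subset msupp g <= s}.
  move=> [Sg gm] k kg; have := Ss _ Sg k kg; rewrite inE => /orP[/eqP km|//].
  by move: kg; rewrite km mcoeff_msupp gm eqxx.
have proj := IH S' sS' S's.
have [[g [Sg gm]]|nog] := pselect (exists g, S g /\ g@_m <> 0); last first.
  have [u [Su _] uP] := proj f; exists u => // g Sg; apply: uP; split=> //.
  by apply: contrapT => gm; apply: nog; exists g.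
(* Subtracting from [g] its projection to [S'] gives [g'], orthogonal to [S'] and still with a
   nonzero coefficient at [m]; [S] is then the span of [S'] and [g']. *)
have [w [Sw wm] wP] := proj g; set g' := g - w in wP.
have Sg' : S g' by apply: subspaceB.
have g'm : g'@_m != 0 by apply/eqP; rewrite mcoeffB wm subr0.
have gg : fischer g' g' != 0.
  by apply: contra_neq g'm => /fischer_eq0 ->; rewrite mcoeff0.
have [u [Su um] uP] := proj f.
pose c := fischer (f - u) g' / fischer g' g'.
exists (u + c *: g'); first by apply: subspaceD => //; apply: subspaceZ.
move=> h Sh; pose d := h@_m / g'@_m.
have S'h : S' (h - d *: g').
  split; first by apply: subspaceB => //; apply: subspaceZ.
  by rewrite mcoeffB mcoeffZ divfK // subrr.
have -> : h = d *: g' + (h - d *: g') by rewrite addrC subrK.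
rewrite opprD addrA fischerBl fischerZl !fischerPr !(uP _ S'h) !(wP _ S'h).
rewrite /c; field.
exact: gg.
Qed.

End FischerForm.

(** * Derivations of the polynomial ring *)

Section Derivations.
Variables (C : numClosedFieldType) (N : nat).
Local Notation B := {mpoly C[N]}.
Implicit Types (f g h : B) (m : 'X_{1..N}) (T : B -> B).

Definition derivation T : Prop :=
  (forall c f g, T (c *: f + g) = c *: T f + T g) /\
  (forall f g, T (f * g) = T f * g + f * T g).

Lemma derivation_xd k l : derivation (xd k l : B -> B).
Proof.
split=> [c f g|f g]; rewrite /xd.
  by rewrite mderivD mderivZ mulrDr scalerAr.
by rewrite mderivM mulrDr !mulrA (mulrC f).
Qed.

Lemma derivationD T T' :
  derivation T -> derivation T' -> derivation (fun f => T f + T' f).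
Proof.
move=> [TL TM] [T'L T'M]; split=> [c f g|f g].
  by rewrite TL T'L scalerDr addrACA.
by rewrite TM T'M mulrDl mulrDr addrACA.
Qed.

Lemma derivation_sum n (T : 'I_n -> B -> B) :
  (forall i, derivation (T i)) -> derivation (fun f => \sum_i T i f).
Proof.
move=> dT; split=> [c f g|f g].
  rewrite scaler_sumr -big_split; apply: eq_bigr => i _.
  by case: (dT i) => ->.
rewrite mulr_suml mulr_sumr -big_split; apply: eq_bigr => i _.
by case: (dT i) => _ ->.
Qed.

Section Laws.
Variables (T : B -> B) (dT : derivation T).

Lemma derivD f g : T (f + g) = T f + T g.
Proof. by rewrite -{1}[f]scale1r dT.1 scale1r. Qed.

Lemma deriv0 : T 0 = 0.
Proof. by have /eqP := derivD 0 0; rewrite addr0 -subr_eq0 opprD addNKr oppr_eq0 => /eqP. Qed.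

Lemma derivZ c f : T (c *: f) = c *: T f.
Proof. by rewrite -[c *: f]addr0 dT.1 deriv0 addr0. Qed.

Lemma derivB f g : T (f - g) = T f - T g.
Proof. by rewrite derivD -scaleN1r derivZ scaleN1r. Qed.

Lemma deriv1 : T 1 = 0.
Proof.
by have /eqP := dT.2 1 1; rewrite !mulr1 mul1r -subr_eq0 opprD addNKr oppr_eq0 => /eqP.
Qed.

Lemma deriv_eigenX f (c : C) k :
  T f = c *: f -> T (f ^+ k) = (c *+ k) *: f ^+ k.
Proof.
move=> Tf; elim: k => [|k IH]; first by rewrite deriv1 scale0r.
by rewrite exprS dT.2 Tf IH mulrS scalerDl -scalerAl -scalerAr.
Qed.

Lemma deriv_prod_eq0 (I : eqType) (r : seq I) (G : I -> B) :
  (forall i, i \in r -> T (G i) = 0) -> T (\prod_(i <- r) G i) = 0.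
Proof.
elim: r => [|i r IH] TG; first by rewrite big_nil deriv1.
rewrite big_cons dT.2 IH ?TG ?inE ?eqxx // => [|j jr].
  by rewrite mul0r mulr0 addr0.
by apply: TG; rewrite inE jr orbT.
Qed.

End Laws.

Lemma xdX k l i : xd k l 'X_i = (l == i)%:R *: 'X_k :> B.
Proof.
rewrite /xd mderivX mnm1E eq_sym; case: eqP => [->|_].
  rewrite !scale1r (_ : _ - _ = 0)%MM ?mpolyX0 ?mulr1 //.
  by apply/mnmP => j; rewrite mnmBE subnn mnm0E.
by rewrite !scale0r mulr0.
Qed.

Lemma mcoeff_xd k l f m :
  (xd k l f)@_(m + U_(k))%MM = f@_(m + U_(l))%MM *+ (m l).+1.
Proof. by rewrite /xd (mulrC 'X_k) addmC mcoeffMX mcoeff_deriv. Qed.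

Lemma msupp_xd k l f m : m \in msupp (xd k l f) ->
  exists2 m1, m = (m1 + U_(k))%MM & (m1 + U_(l))%MM \in msupp f.
Proof.
rewrite /xd (mulrC 'X_k) (perm_mem (msuppMX _ _)) => /mapP[m1 m1f ->].
exists m1; first by rewrite addmC.
move: m1f; rewrite !mcoeff_msupp mcoeff_deriv.
by apply: contraNneq => ->; rewrite mul0rn.
Qed.

Lemma mcoeff_xd_eq0 k l f m : m k = 0%N -> (xd k l f)@_m = 0.
Proof.
move=> mk; apply: memN_msupp_eq0; apply/negP => /msupp_xd[m1 mE _].
by move: mk; rewrite mE mnmDE mnm1E eqxx addn1.
Qed.

(** Together with the next lemma it reduces the commutation of two derivations to a check on the
    variables. *)
Lemma derivation_eq0 T :
  derivation T -> (forall k, T 'X_k = 0) -> forall f, T f = 0.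
Proof.
move=> dT TX; elim/mpolyind => [|c m f _ _ IH]; first exact: deriv0.
rewrite dT.1 IH addr0 mpolyXE_id.
rewrite deriv_prod_eq0 ?scaler0 // => i _.
by rewrite (@deriv_eigenX _ dT 'X_i 0) ?TX ?scale0r // mul0rn scale0r.
Qed.

Lemma derivation_commutator T T' :
  derivation T -> derivation T' -> derivation (fun f => T (T' f) - T' (T f)).
Proof.
move=> dT dT'; split=> [c f g|f g].
  by rewrite dT'.1 dT.1 dT.1 dT'.1 scalerBr opprD addrACA.
by rewrite dT'.2 dT.2 (derivD dT) (derivD dT') !dT.2 !dT'.2; ring.
Qed.

End Derivations.

(** * Polynomials in two groups of variables, and their bidegrees *)

Section Bigraded.
Variables (C : numClosedFieldType) (n N : nat) (a b : 'I_n -> 'I_N).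
Hypotheses (a_inj : injective a) (b_inj : injective b).
Hypothesis ab_neq : forall i j, a i != b j.
Hypothesis ab_cover :
  forall G : 'I_N -> nat, (\sum_k G k = \sum_i G (a i) + \sum_i G (b i))%N.
Local Notation B := {mpoly C[N]}.
Implicit Types (f g h : B) (m : 'X_{1..N}) (p q : int) (S : B -> Prop).
Implicit Types (A : 'M[C]_n).

(** Used with [c] constantly 1, for the two degrees, and with [c] equal to [val], for the sum of the
    indices of the variables, which orders monomials below. *)
Definition wt (z : 'I_n -> 'I_N) (c : 'I_n -> nat) m : nat :=
  (\sum_i c i * m (z i))%N.

Lemma wtD z c m1 m2 : wt z c (m1 + m2)%MM = (wt z c m1 + wt z c m2)%N.
Proof.
by rewrite /wt -big_split; apply: eq_bigr => i _; rewrite mnmDE mulnDr.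
Qed.

Lemma wtUE z c i : injective z -> wt z c U_(z i)%MM = c i.
Proof.
move=> zi; rewrite /wt (bigD1 i) //= mnm1E eqxx muln1 big1 ?addn0 // => j ji.
by rewrite mnm1E (inj_eq zi) eq_sym (negbTE ji) muln0.
Qed.

Lemma wtU_eq0 z c k : (forall i, z i != k) -> wt z c U_(k)%MM = 0%N.
Proof.
move=> zk; rewrite /wt big1 // => i _.
by rewrite mnm1E eq_sym (negbTE (zk i)) muln0.
Qed.

Lemma wtU c i :
  [/\ wt a c U_(a i)%MM = c i, wt a c U_(b i)%MM = 0%N,
      wt b c U_(a i)%MM = 0%N & wt b c U_(b i)%MM = c i].
Proof.
by split; rewrite ?wtUE // wtU_eq0 // => j; rewrite // eq_sym.
Qed.

Definition dga := wt a (fun=> 1%N).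
Definition dgb := wt b (fun=> 1%N).

Lemma mdeg_ab m : mdeg m = (dga m + dgb m)%N.
Proof.
by rewrite mdegE ab_cover; congr (_ + _)%N; apply: eq_bigr => i _; rewrite mul1n.
Qed.

(** Degrees are integers so that shifts by one are never truncated; for a negative [p] or [q] only
    the zero polynomial qualifies. *)
Definition bihom p q f : Prop :=
  forall m, m \in msupp f -> (dga m)%:Z = p /\ (dgb m)%:Z = q.

Lemma bihom_subspace p q : subspace (bihom p q).
Proof.
split=> [m|c f g fpq gpq m]; first by rewrite msupp0.
by move=> /msuppD_le; rewrite mem_cat => /orP[/msuppZ_le/fpq|/gpq].
Qed.

Lemma bihomM p q p' q' f g :
  bihom p q f -> bihom p' q' g -> bihom (p + p') (q + q') (f * g).
Proof.
move=> fpq gpq m /msuppM_le/allpairsP[[m1 m2] /= [/fpq[p1 q1] /gpq[p2 q2] ->]].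
by rewrite /dga /dgb !wtD !PoszD p1 p2 q1 q2.
Qed.

Lemma bihom1 : bihom 0 0 1.
Proof.
by move=> m; rewrite msupp1 inE => /eqP ->; rewrite /dga /dgb /wt !big1 // => i _;
  rewrite mnm0E.
Qed.

Lemma bihomX k : bihom (dga U_(k)%MM) (dgb U_(k)%MM) 'X_k.
Proof. by move=> m; rewrite msuppX inE => /eqP ->. Qed.

Lemma bihom_xd p q k l f : bihom p q f ->
  bihom (p + (dga U_(k)%MM)%:Z - (dga U_(l)%MM)%:Z)
        (q + (dgb U_(k)%MM)%:Z - (dgb U_(l)%MM)%:Z) (xd k l f).
Proof.
move=> fpq m /msupp_xd[m1 -> /fpq[<- <-]].
by rewrite /dga /dgb !wtD !PoszD; split; ring.
Qed.

Arguments bihom_xd [p q] k l [f].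

Lemma bihom_bounded p q :
  exists s : seq 'X_{1..N}, forall f, bihom p q f -> {subset msupp f <= s}.
Proof.
pose k := (absz p + absz q).+1.
exists (map (fun m : 'X_{1..N < k} => m : 'X_{1..N}) (enum {: 'X_{1..N < k}})).
move=> f fpq m /fpq[mp mq].
have mb : (mdeg m < k)%N by rewrite /k mdeg_ab -mp -mq.
by apply/mapP; exists (BMultinom mb); rewrite ?mem_enum.
Qed.

(** * The operators, and the decomposition into kernel and image *)

Definition De f : B := \sum_i xd (a i) (b i) f.
Definition Deta f : B := \sum_i xd (b i) (a i) f.
(** With [a] the x and [b] the y, [De] is [- DeltaB], [Deta] is [etaB], and [D i j] is minus the
    derivation part of [Eact i j]. Exchanging [a] and [b] exchanges the first two and preserves
    [D i j]. *)
Definition D i j f : B := xd (a j) (a i) f + xd (b j) (b i) f.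

Lemma derivation_De : derivation De.
Proof. by apply: derivation_sum => i; apply: derivation_xd. Qed.
Lemma derivation_Deta : derivation Deta.
Proof. by apply: derivation_sum => i; apply: derivation_xd. Qed.
Lemma derivation_D i j : derivation (D i j).
Proof. by apply: derivationD; apply: derivation_xd. Qed.
Hint Resolve derivation_De derivation_Deta derivation_D : core.

Lemma bihom_De p q f : bihom p q f -> bihom (p + 1) (q - 1) (De f).
Proof.
move=> fpq; apply: (subspace_sum (bihom_subspace _ _)) => i _.
have := bihom_xd (a i) (b i) fpq; rewrite /dga /dgb.
by case: (wtU (fun=> 1%N) i) => -> -> -> ->; rewrite addr0 subr0.
Qed.

Lemma bihom_Deta p q f : bihom p q f -> bihom (p - 1) (q + 1) (Deta f).
Proof.
move=> fpq; apply: (subspace_sum (bihom_subspace _ _)) => i _.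
have := bihom_xd (b i) (a i) fpq; rewrite /dga /dgb.
by case: (wtU (fun=> 1%N) i) => -> -> -> ->; rewrite addr0 subr0.
Qed.

Lemma bihom_D p q i j f : bihom p q f -> bihom p q (D i j f).
Proof.
move=> fpq; apply: (subspaceD (bihom_subspace p q)).
  have := bihom_xd (a j) (a i) fpq; rewrite /dga /dgb.
  by case: (wtU (fun=> 1%N) i) (wtU (fun=> 1%N) j) => -> _ -> _ [-> _ -> _]; rewrite !addrK.
have := bihom_xd (b j) (b i) fpq; rewrite /dga /dgb.
by case: (wtU (fun=> 1%N) i) (wtU (fun=> 1%N) j) => _ -> _ -> [_ -> _ ->]; rewrite !addrK.
Qed.

Lemma fischer_De f g : fischer (De f) g = fischer f (Deta g).
Proof.
by rewrite fischer_suml fischer_sumr; apply: eq_bigr => i _; rewrite fischer_xd.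
Qed.

Lemma fischer_Deta f g : fischer (Deta f) g = fischer f (De g).
Proof. by rewrite fischerC -fischer_De -fischerC. Qed.

Lemma fischer_D i j f g : fischer (D i j f) g = fischer f (D j i g).
Proof. by rewrite fischerDl fischerDr !fischer_xd. Qed.

(** The covering identity is applied to the indicator of [k]: its left side is positive, so [k] is a
    value of [a] or of [b]. *)
Lemma index_ab k : (exists i, k = a i) \/ (exists i, k = b i).
Proof.
have := ab_cover (fun l => (l == k) : nat).
rewrite (bigD1 k) //= eqxx => E.
have [/existsP[i /eqP <-]|na] := boolP [exists i, a i == k]; first by left; exists i.
have [/existsP[i /eqP <-]|nb] := boolP [exists i, b i == k]; first by right; exists i.
move: E; rewrite [X in _ = (X + _)%N]big1 => [|i _]; last first.
  by move: na; rewrite negb_exists => /forallP/(_ i)/negbTE ->.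
rewrite [X in _ = (_ + X)%N]big1 // => i _.
by move: nb; rewrite negb_exists => /forallP/(_ i)/negbTE ->.
Qed.

Lemma D_a i j t : D i j 'X_(a t) = (i == t)%:R *: 'X_(a j).
Proof.
by rewrite /D !xdX (inj_eq a_inj) eq_sym [b i == _]eq_sym (negbTE (ab_neq _ _))
  scale0r addr0 eq_sym.
Qed.

Lemma D_b i j t : D i j 'X_(b t) = (i == t)%:R *: 'X_(b j).
Proof. by rewrite /D !xdX (inj_eq b_inj) (negbTE (ab_neq _ _)) scale0r add0r. Qed.

Lemma De_a t : De 'X_(a t) = 0.
Proof.
rewrite /De big1 // => i _.
by rewrite xdX eq_sym (negbTE (ab_neq _ _)) scale0r.
Qed.

Lemma De_b t : De 'X_(b t) = 'X_(a t).
Proof.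
rewrite /De (bigD1 t) //= xdX eqxx scale1r big1 ?addr0 // => i it.
by rewrite xdX (inj_eq b_inj) (negbTE it) scale0r.
Qed.

Lemma De_D i j f : De (D i j f) = D i j (De f).
Proof.
apply/eqP; rewrite -subr_eq0; apply/eqP; move: f.
apply: derivation_eq0 => [|k]; first exact: derivation_commutator.
have [[t ->]|[t ->]] := index_ab k.
  rewrite D_a De_a (derivZ derivation_De) De_a (deriv0 (derivation_D i j)).
  by rewrite scaler0 subrr.
by rewrite D_b De_b D_a (derivZ derivation_De) De_b subrr.
Qed.

Definition Hker p q f : Prop := bihom p q f /\ De f = 0.

Lemma Hker_subspace p q : subspace (Hker p q).
Proof.
split=> [|c f g [fpq f0] [gpq g0]].
  by split; [case: (bihom_subspace p q) | rewrite (deriv0 derivation_De)].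
split; first by case: (bihom_subspace p q) => _; apply.
by rewrite derivation_De.1 f0 g0 scaler0 addr0.
Qed.

Lemma bihom_decomposition p q :
  is_direct_sum (bihom p q) (Hker p q) (im_of Deta (bihom (p + 1) (q - 1))).
Proof.
have sB := bihom_subspace p q.
have imB f : im_of Deta (bihom (p + 1) (q - 1)) f -> bihom p q f.
  by move=> [g /bihom_Deta gpq ->]; rewrite !(addrK, subrK) in gpq.
have sI : subspace (im_of Deta (bihom (p + 1) (q - 1))).
  have sB1 := bihom_subspace (p + 1) (q - 1).
  split; first by exists 0; [case: sB1 | rewrite (deriv0 derivation_Deta)].
  move=> c _ _ [f fB ->] [g gB ->]; exists (c *: f + g); first by case: sB1 => _; apply.
  by rewrite derivation_Deta.1.
split=> // [||f [_ f0] [g gB fE]].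
- exact: Hker_subspace.
- move=> f; split=> [fB|[u [w [[uB _] /imB wB ->]]]]; last exact: (subspaceD sB uB wB).
  have [s sP] := bihom_bounded p q.
  have [w wI wP] := fischer_projection sI (fun g gI => sP g (imB g gI)) f.
  have fwB : bihom p q (f - w) by apply: (subspaceB sB) => //; apply: imB.
  exists (f - w), w; split=> //; last by rewrite subrK.
  (* For [h = f - w], orthogonal to the image of [Deta], the norm of [De h] is the product of [h]
     with [Deta (De h)], hence zero. *)
  split=> //; apply: fischer_eq0; rewrite fischer_De; apply: wP.
  by exists (De (f - w)) => //; apply: bihom_De.
- by apply: fischer_eq0; rewrite {1}fE fischer_Deta f0 fischer0r.
Qed.

(** * The action of the special linear algebra *)

(** The trace collects the constants $-\delta_{i,j}$; on [sl] it vanishes and a derivation is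
    left. *)
Definition gact A f : B := - (\sum_i \sum_j A i j *: D i j f) - \tr A *: f.

Lemma gactPl c A A' f : gact (c *: A + A') f = c *: gact A f + gact A' f.
Proof.
rewrite /gact mxtraceD mxtraceZ scalerDl scalerBr scalerN scaler_sumr scalerA.
rewrite addrACA -!opprD -big_split /=; congr (- (_ + _)).
apply: eq_bigr => i _; rewrite scaler_sumr -big_split; apply: eq_bigr => j _ /=.
by rewrite !mxE scalerDl scalerA.
Qed.

Lemma gact0 f : gact 0 f = 0.
Proof.
rewrite /gact mxtrace0 scale0r subr0 big1 ?oppr0 // => i _.
by rewrite big1 // => j _; rewrite mxE scale0r.
Qed.

Lemma gactZl c A f : gact (c *: A) f = c *: gact A f.
Proof. by rewrite -[c *: A]addr0 gactPl gact0 addr0. Qed.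

Lemma gact_suml (I : Type) (r : seq I) (P : pred I) (G : I -> 'M[C]_n) f :
  gact (\sum_(i <- r | P i) G i) f = \sum_(i <- r | P i) gact (G i) f.
Proof.
apply: (big_morph (fun A => gact A f)) => [A A'|]; last exact: gact0.
by rewrite -[A in gact (A + _)]scale1r gactPl scale1r.
Qed.

Lemma gact_delta i j f : i != j -> gact (delta_mx i j) f = - D i j f.
Proof.
move=> ij; rewrite /gact /mxtrace (bigD1 i) //= (bigD1 j) //= !mxE !eqxx scale1r.
rewrite big1 => [|l /negbTE lj]; last by rewrite mxE lj andbF scale0r.
rewrite big1 => [|l /negbTE li]; last first.
  by rewrite big1 // => s _; rewrite mxE li scale0r.
rewrite big1 => [|l _]; last by rewrite !mxE; case: eqP => //= ->; rewrite (negbTE ij).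
by rewrite scale0r !addr0 subr0.
Qed.

Lemma gact_sl A f : sl A -> gact A f = - \sum_i \sum_j A i j *: D i j f.
Proof. by rewrite /gact => ->; rewrite scale0r subr0. Qed.

Lemma submodule_D S i j f : submodule gact S -> i != j -> S f -> S (D i j f).
Proof.
move=> [sS SA] ij Sf; rewrite -[D i j f]opprK -gact_delta //.
apply: (subspaceN sS); apply: SA => //; rewrite /sl /mxtrace big1 // => l _.
by rewrite mxE; case: eqP => //= ->; rewrite (negbTE ij).
Qed.

(** A sufficient criterion only: the single operators [D i i] come from matrices of trace 1. The
    subspaces it is applied to are stable under these as well. *)
Lemma submodule_of_D S : subspace S ->
  (forall i j f, S f -> S (D i j f)) -> submodule gact S.
Proof.
move=> sS SD; split=> // A f slA Sf; rewrite gact_sl //; apply: (subspaceN sS).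
apply: (subspace_sum sS) => i _; apply: (subspace_sum sS) => j _.
by apply: (subspaceZ sS); apply: SD.
Qed.

Lemma Hker_submodule p q : submodule gact (Hker p q).
Proof.
apply: submodule_of_D; first exact: Hker_subspace.
move=> i j f [fB f0]; split; first exact: bihom_D.
by rewrite De_D f0 (deriv0 (derivation_D i j)).
Qed.

Lemma sl_adjoint A : sl A -> sl (map_mx Num.conj A^T).
Proof.
rewrite /sl /mxtrace => slA; under eq_bigr => i _ do rewrite !mxE.
by rewrite -rmorph_sum slA rmorph0.
Qed.

(** The adjoint of a matrix is its conjugate transpose, again of trace zero: the form is invariant
    under su(n), in algebraic terms. *)
Lemma fischer_gact A f g : sl A ->
  fischer (gact A f) g = fischer f (gact (map_mx Num.conj A^T) g).
Proof.
move=> slA; have slA' : sl (map_mx Num.conj A^T).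
  exact: sl_adjoint.
rewrite !gact_sl // fischerNl fischerNr exchange_big fischer_suml fischer_sumr.
congr (- _); apply: eq_bigr => i _; rewrite fischer_suml fischer_sumr.
apply: eq_bigr => j _; rewrite fischerZl fischer_D fischerZr.
by rewrite !mxE conjCK.
Qed.

Lemma submodule_orthogonal S p q : submodule gact S ->
  submodule gact (fun f => Hker p q f /\ forall g, S g -> fischer f g = 0).
Proof.
move=> [_ SA]; have [[H0 HL] HA] := Hker_submodule p q.
split=> [|A f slA [fH fS]].
  split=> [|c f g [fH fS] [gH gS]]; split; [by []| |exact: HL|].
    by move=> g _; rewrite fischer0l.
  by move=> h Sh; rewrite fischerPl fS // gS // mulr0 addr0.
split=> [|g Sg]; first exact: HA.
rewrite fischer_gact //; apply: fS; apply: SA => //.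
exact: sl_adjoint.
Qed.

(** * Highest vectors and irreducibility *)

Definition highest f : Prop := forall i j : 'I_n, (i < j)%N -> D i j f = 0.

(** For [i < j], [D i j] replaces an index [i] by [j] and so raises the sum [w] of the indices in
    every monomial. As [w] is bounded on the finitely many monomials of a bidegree, a nonzero vector
    cannot be raised forever. *)
Lemma exists_highest S p q : submodule gact S -> (forall f, S f -> bihom p q f) ->
  (exists2 f, S f & f <> 0) -> exists2 f, S f & f <> 0 /\ highest f.
Proof.
move=> sS SB [f0 Sf0 f0n0]; apply: contrapT => noh.
pose w m := (wt a val m + wt b val m)%N.
have [s sP] := bihom_bounded p q.
have step k : exists2 f, S f & f <> 0 /\ forall m, m \in msupp f -> (k <= w m)%N.
  elim: k => [|k [f Sf [fn0 fk]]]; first by exists f0.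
  have [fh|/existsNP[i /existsNP[j /not_implyP[ij Dn0]]]] := pselect (highest f).
    by case: noh; exists f.
  have Sf' : S (D i j f) by apply: submodule_D => //; rewrite neq_ltn ij.
  exists (D i j f) => //; split=> // m /msuppD_le.
  rewrite mem_cat => /orP[] /msupp_xd[m1 -> /fk].
    rewrite /w !wtD; case: (wtU val i) (wtU val j) => -> _ -> _ [-> _ -> _].
    by move: ij => /=; lia.
  rewrite /w !wtD; case: (wtU val i) (wtU val j) => _ -> _ -> [_ -> _ ->].
  by move: ij => /=; lia.
have [f Sf [fn0 fk]] := step (\max_(m <- s) w m).+1.
case E: (msupp f) => [|m t]; first by case: fn0; apply: msuppnil0.
have mf : m \in msupp f by rewrite E inE eqxx.
have := fk m mf; rewrite ltnNge => /negP; apply.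
by apply: leq_bigmax_seq => //; apply: (sP _ (SB _ Sf)).
Qed.

Lemma mnm_pos m k : (0 < m k)%N -> exists m1, m = (m1 + U_(k))%MM.
Proof.
move=> mk; exists (m - U_(k))%MM; apply/mnmP => i; rewrite mnmDE mnmBE mnm1E.
by case: eqP => [<-|_]; rewrite ?subnK // subn0 addn0.
Qed.

Variables (lst prv : 'I_n).
Hypotheses (lstE : val lst = n.-1) (prvE : val prv = n.-2) (n_gt1 : (1 < n)%N).

Lemma lt_lst i : i != lst -> (i < lst)%N.
Proof. by rewrite -val_eqE /=; move: lstE (ltn_ord i) => /= ->; lia. Qed.

Lemma lt_prv i : i != lst -> i != prv -> (i < prv)%N.
Proof.
by rewrite -!val_eqE /=; move: lstE prvE (ltn_ord i) => /= -> ->; lia.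
Qed.

Lemma prv_lst : (prv < lst)%N.
Proof. by move: lstE prvE => /= -> ->; move: n_gt1; lia. Qed.

(** A monomial [m] of [f] with the largest sum of [a]-indices must be the one displayed: any other
    variable in [m] could be replaced through one of the equations satisfied by [f], and comparing
    one coefficient there would give [f@_m = 0]. *)
Lemma highest_coeff p q f : Hker p q f -> highest f -> f <> 0 ->
  f@_(U_(a lst) *+ absz p + U_(b prv) *+ absz q)%MM != 0.
Proof.
move=> [fB f0] fh fn0.
have [m mf mmax] : exists2 m, m \in msupp f &
    forall m', m' \in msupp f -> (wt a val m' <= wt a val m)%N.
  by apply: seq_argmax => /msuppnil0.
have fm : f@_m != 0 by rewrite -mcoeff_msupp.
have fmS k : f@_m *+ k.+1 <> 0 by apply/eqP; rewrite mulrn_eq0.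
have ma i : i != lst -> m (a i) = 0%N.
  move=> il; apply/eqP; rewrite -leqn0 leqNgt; apply/negP => /mnm_pos[m1 mE].
  apply: (fmS (m1 (a i))).
  have := congr1 (mcoeff (m1 + U_(a lst))%MM) (fh i lst (lt_lst il)).
  rewrite mcoeff0 mcoeffD mcoeff_xd -mE => <-; rewrite [X in _ + X]memN_msupp_eq0 ?addr0 //.
  apply/negP => /msupp_xd[m2 m2E /mmax]; rewrite leqNgt => /negP; apply.
  have := congr1 (wt a val) m2E; rewrite mE !wtD.
  case: (wtU val i) (wtU val lst) => -> -> _ _ [-> -> _ _].
  by move: (lt_lst il) => /=; lia.
have mb i : i != prv -> m (b i) = 0%N.
  move=> ip; apply/eqP; rewrite -leqn0 leqNgt; apply/negP => /mnm_pos[m1 mE].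
  apply: (fmS (m1 (b i))).
  have m1a s : s != lst -> m1 (a s) = 0%N.
    by move/ma; rewrite mE mnmDE mnm1E eq_sym (negbTE (ab_neq _ _)) addn0.
  (* The index [lst] on the [b] side is excluded by [De f = 0] and every other one by
     [D i prv f = 0]. The remaining contributions vanish because [lst] is by now the only index on
     the [a] side. *)
  have [il|il] := eqVneq i lst.
    have := congr1 (mcoeff (m1 + U_(a lst))%MM) f0.
    rewrite mcoeff0 /De (bigD1 lst) //= mcoeffD mcoeff_xd -il -mE => <-.
    rewrite raddf_sum /= big1 ?addr0 // => s sl; apply: mcoeff_xd_eq0.
    by rewrite mnmDE mnm1E (inj_eq a_inj) eq_sym (negbTE sl) addn0 m1a -?il.
  have := congr1 (mcoeff (m1 + U_(b prv))%MM) (fh i prv (lt_prv il ip)).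
  rewrite mcoeff0 mcoeffD mcoeff_xd -mE => <-; rewrite [X in X + _]mcoeff_xd_eq0 ?add0r //.
  rewrite mnmDE mnm1E eq_sym (negbTE (ab_neq _ _)) addn0 m1a //.
  by rewrite neq_ltn prv_lst.
have [pE qE] := fB m mf.
suff -> : (U_(a lst) *+ absz p + U_(b prv) *+ absz q)%MM = m by [].
apply/mnmP => k; rewrite mnmDE !mulmnE !mnm1E -pE -qE !absz_nat.
have [[i ->]|[i ->]] := index_ab k.
  rewrite (inj_eq a_inj) [b _ == _]eq_sym (negbTE (ab_neq _ _)) addn0.
  have [<-|il] := eqVneq lst i; last by rewrite ma // eq_sym.
  rewrite /dga /wt (bigD1 lst) //= big1 => [|s /ma ->]; last by rewrite muln0.
  by rewrite !mul1n addn0.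
rewrite (inj_eq b_inj) (negbTE (ab_neq _ _)) add0n.
have [<-|il] := eqVneq prv i; last by rewrite mb // eq_sym.
rewrite /dgb /wt (bigD1 prv) //= big1 => [|s /mb ->]; last by rewrite muln0.
by rewrite !mul1n addn0.
Qed.

(** The combination of [f] and [g] without the decisive monomial is again highest in the kernel, so
    it is zero. *)
Lemma highest_unique p q f g : Hker p q f -> highest f ->
  Hker p q g -> highest g -> g <> 0 -> exists c, f = c *: g.
Proof.
move=> fH fh gH gh gn0; have g0 := highest_coeff gH gh gn0.
set m := (_ + _)%MM in g0; exists (f@_m / g@_m).
apply/eqP; rewrite -subr_eq0; apply: contraT => /eqP fgn0.
have sH := Hker_subspace p q.
have /eqP[] : (f - (f@_m / g@_m) *: g)@_m != 0.
  apply: (highest_coeff _ _ fgn0) => [|i j ij].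
    by apply: (subspaceB sH) => //; apply: (subspaceZ sH).
  rewrite (derivB (derivation_D i j)) (derivZ (derivation_D i j)).
  by rewrite fh // gh // scaler0 subr0.
by rewrite mcoeffB mcoeffZ divfK // subrr.
Qed.

Lemma irreducible_Hker p q v : Hker p q v -> highest v -> v <> 0 ->
  irreducible_module gact (Hker p q).
Proof.
move=> vH vh vn0; have sH := Hker_subspace p q.
split; [exact: Hker_submodule|by exists v|move=> S sS SH].
(* Every nonzero submodule of the kernel contains [v] itself; this is used for [S] and for its
   orthogonal complement. *)
have hasv S' : submodule gact S' -> (forall f, S' f -> Hker p q f) ->
    (exists2 f, S' f & f <> 0) -> S' v.
  move=> sS' S'H S'n0.
  have [f S'f [fn0 fh]] := exists_highest sS' (fun f S'f => (S'H f S'f).1) S'n0.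
  have [c ->] := highest_unique vH vh (S'H _ S'f) fh fn0.
  by apply: (subspaceZ sS'.1).
have [S0|Sn0] := pselect (forall f, S f -> f = 0); [by left|right].
have Sv : S v.
  apply: hasv => //; apply: contrapT => no; apply: Sn0 => f Sf.
  by apply: contrapT => fn0; apply: no; exists f.
move=> f fH; have [s sP] := bihom_bounded p q.
have [u Su uP] := fischer_projection sS.1 (fun g Sg => sP g (SH g Sg).1) f.
have sO := submodule_orthogonal p q sS.
have [fu|fun0] := pselect (f - u = 0).
  by move/eqP: fu; rewrite subr_eq0 => /eqP ->.
have [_ /(_ v Sv)] : Hker p q v /\ forall g, S g -> fischer v g = 0.
  apply: (hasv _ sO) => [g []//|].
  exists (f - u) => //; split=> //.
  by apply: (subspaceB sH) => //; apply: SH.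
by move=> /fischer_eq0.
Qed.

(** [generated_by] tests submodules of the whole space, irreducibility those inside [M]; the
    intersection with [M] mediates. *)
Lemma irreducible_generated M v : irreducible_module gact M ->
  M v -> v <> 0 -> generated_by gact M v.
Proof.
move=> [[sM MA] _ irr] Mv vn0; split=> // S [sS SA] Sv w Mw.
have [|f []//|S0|MS] := irr (fun f => S f /\ M f).
- split=> [|A f slA [Sf Mf]]; last by split; [apply: SA | apply: MA].
  split=> [|c f g [Sf Mf] [Sg Mg]]; first by split; [case: sS | case: sM].
  by split; [case: sS => _; apply | case: sM => _; apply].
- by case: vn0; apply: S0.
- by case: (MS w Mw).
Qed.

(** * Products of variables and minors *)

Variable eps : C.
Hypothesis eps_neq0 : eps != 0.

(* [(None, t)] stands for a variable and [(Some i, j)] for a minor: a variable is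
   treated as a minor whose first index precedes all others, so that every
   straightening rule is an instance of the three-term Pluecker relation. *)
Local Notation G := (option 'I_n * 'I_n)%type.
Implicit Types (c d : G) (s t : seq G).

Definition gen c : B :=
  if c.1 is Some i then eps *: ('X_(a i) * 'X_(b c.2) - 'X_(a c.2) * 'X_(b i))
  else 'X_(a c.2).

(** The shift by one reserves 0 for the missing index of a variable; [increasing] shifts the second
    index to match. *)
Definition fst_idx c : nat := oapp (fun i : 'I_n => i.+1) 0%N c.1.
Definition increasing c := (fst_idx c < c.2.+1)%N.
(** Covers both exclusion conditions of the theorem: the one between a variable and a minor when [c]
    is a variable, the one between two minors otherwise. *)
Definition nested c d := (fst_idx c < fst_idx d)%N && (d.2 < c.2)%N.

Definition nvar s := count (fun c => c.1 == None) s.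
Definition nminor s := count (fun c => c.1 != None) s.
Definition gen_prod s : B := \prod_(c <- s) gen c.

Definition standard s :=
  all increasing s /\ {in s &, forall c d, ~~ nested c d}.

Definition standard_poly k l f :=
  exists s, [/\ standard s, nvar s = k, nminor s = l & f = gen_prod s].

Lemma gen_prod_cons c s : gen_prod (c :: s) = gen c * gen_prod s.
Proof. exact: big_cons. Qed.

Lemma De_gen c : De (gen c) = 0.
Proof.
case: c => [[i|] j]; rewrite /gen /=; last exact: De_a.
rewrite (derivZ derivation_De) (derivB derivation_De) !derivation_De.2.
by rewrite !De_a !De_b !mul0r !add0r mulrC subrr scaler0.
Qed.

Lemma D_gen_var i j l : D i j (gen (None, l)) = (i == l)%:R *: gen (None, j).
Proof. exact: D_a. Qed.

Lemma D_gen_minor i j k l : D i j (gen (Some k, l)) =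
  (i == k)%:R *: gen (Some j, l) + (i == l)%:R *: gen (Some k, j).
Proof.
have dD := derivation_D i j.
rewrite /gen /= (derivZ dD) (derivB dD) !dD.2 !D_a !D_b.
rewrite -!mul_mpolyC; ring.
Qed.

Lemma bihom_var i : bihom 1 0 'X_(a i) /\ bihom 0 1 'X_(b i).
Proof.
have [aa ab ba bb] := wtU (fun=> 1%N) i.
have := @bihomX (a i); have := @bihomX (b i).
by rewrite /dga /dgb aa ab ba bb.
Qed.

Lemma bihom_gen c : bihom 1 (c.1 != None)%:Z (gen c).
Proof.
case: c => [[i|] j]; rewrite /gen /=; last exact: (bihom_var j).1.
have sB := bihom_subspace 1 1; apply: (subspaceZ sB); apply: (subspaceB sB).
  exact: bihomM (bihom_var i).1 (bihom_var j).2.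
exact: bihomM (bihom_var j).1 (bihom_var i).2.
Qed.

(** Each factor has [a]-degree 1, a minor also has [b]-degree 1, and the derivation [De] kills every
    factor. *)
Lemma Hker_gen_prod s :
  Hker (nvar s + nminor s)%N%:Z (nminor s)%:Z (gen_prod s).
Proof.
split; last first.
  by apply: deriv_prod_eq0 => // c _; apply: De_gen.
elim: s => [|c s IH]; first by rewrite /gen_prod big_nil; apply: bihom1.
rewrite gen_prod_cons.
have -> : (nvar (c :: s) + nminor (c :: s))%N%:Z = 1 + (nvar s + nminor s)%N%:Z.
  by rewrite /nvar /nminor /=; case: c.1 => [?|] /=; lia.
have -> : (nminor (c :: s))%:Z = (c.1 != None)%:Z + (nminor s)%:Z.
  by rewrite /nminor /= PoszD.
exact: (bihomM (@bihom_gen c) IH).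
Qed.

(** The index pairs are not ordered here: [D i j] replaces an index in one factor, which may leave a
    minor with decreasing or equal indices. *)
Definition prod_span k l : B -> Prop :=
  lin_span (fun f => exists s, [/\ nvar s = k, nminor s = l & f = gen_prod s]).

Lemma prod_span_prod s k l : nvar s = k -> nminor s = l ->
  prod_span k l (gen_prod s).
Proof. by move=> sk sl; apply: lin_span_incl; exists s. Qed.

Lemma prod_span_mul c k l f : prod_span k l f ->
  prod_span ((c.1 == None) + k) ((c.1 != None) + l) (gen c * f).
Proof.
have [S0 SL] : subspace (prod_span ((c.1 == None) + k) ((c.1 != None) + l)).
  exact: lin_span_subspace.
apply: (@lin_span_min _ _ _ (fun f => prod_span _ _ (gen c * f))).
  split=> [|z u v Su Sv]; first by rewrite mulr0.
  by rewrite mulrDr -scalerAr; apply: SL.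
move=> _ [s [sk sl ->]]; rewrite -gen_prod_cons; apply: prod_span_prod.
  by rewrite -sk.
by rewrite -sl.
Qed.

Lemma prod_span_D i j s : prod_span (nvar s) (nminor s) (D i j (gen_prod s)).
Proof.
have dD := derivation_D i j.
elim: s => [|c s IH].
  rewrite /gen_prod big_nil (deriv1 dD).
  by case: (lin_span_subspace (fun f => exists s,
    [/\ nvar s = 0, nminor s = 0 & f = gen_prod s]))%N.
rewrite gen_prod_cons dD.2.
have sS := lin_span_subspace (fun f => exists t,
    [/\ nvar t = nvar (c :: s), nminor t = nminor (c :: s) & f = gen_prod t]).
apply: (subspaceD sS); last exact: prod_span_mul.
case: c sS => [[k|] l] sS.
  rewrite D_gen_minor mulrDl -!(scalerAl (_ == _)%:R) -!gen_prod_cons.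
  by apply: (subspaceD sS); apply: (subspaceZ sS); apply: prod_span_prod.
rewrite D_gen_var -(scalerAl (_ == _)%:R) -gen_prod_cons.
by apply: (subspaceZ sS); apply: prod_span_prod.
Qed.

Lemma prod_span_submodule k l : submodule gact (prod_span k l).
Proof.
have sS := lin_span_subspace
  (fun f => exists s, [/\ nvar s = k, nminor s = l & f = gen_prod s]).
apply: submodule_of_D => [|i j f]; first exact: sS.
have dD := derivation_D i j.
apply: (@lin_span_min _ _ _ (fun f => prod_span k l (D i j f))).
  split=> [|z u v Su Sv]; first by rewrite (deriv0 dD); case: sS.
  by rewrite dD.1; case: sS => _; apply.
by move=> _ [s [<- <- ->]]; apply: prod_span_D.
Qed.

(** * Straightening *)

(** For [o = None] this is the expansion of a determinant of order three with rows x, x, y in the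
    case where [a] is x. *)
Lemma plucker (o : option 'I_n) (i1 j1 j : 'I_n) :
  gen (o, j) * gen (Some i1, j1) =
  gen (o, j1) * gen (Some i1, j) - gen (o, i1) * gen (Some j1, j).
Proof.
case: o => [i|]; rewrite /gen /= -?mul_mpolyC; ring.
Qed.

(* Nested index intervals are replaced by crossing or disjoint ones, which
   decreases the sum of the squared lengths. *)
Definition spread s : nat := (\sum_(c <- s) (c.2.+1 - fst_idx c) ^ 2)%N.

(** With $A$, $B$, $C$ the gaps between the end points [x], [i.+1], [j1.+1], [j.+1], the old sum is
    $(A+B+C)^2+B^2$. It exceeds $(A+B)^2+(B+C)^2$ by $2AC$, and $A^2+C^2$ by $2AC+2B(A+B+C)$. *)
Lemma spread_decreases (x i j1 j : nat) : (x < i.+1)%N -> (i < j1)%N -> (j1 < j)%N ->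
  ((j1.+1 - x) ^ 2 + (j.+1 - i.+1) ^ 2 < (j.+1 - x) ^ 2 + (j1.+1 - i.+1) ^ 2)%N /\
  ((i.+1 - x) ^ 2 + (j.+1 - j1.+1) ^ 2 < (j.+1 - x) ^ 2 + (j1.+1 - i.+1) ^ 2)%N.
Proof.
move=> xi ij1 j1j.
have [p ip] : exists p : nat, i.+1 = (x + p.+1)%N by exists (i - x)%N; lia.
have [q iq] : exists q : nat, j1 = (i + q.+1)%N by exists (j1 - i.+1)%N; lia.
have [r ir] : exists r : nat, j = (j1 + r.+1)%N by exists (j - j1.+1)%N; lia.
have -> : (j1.+1 - x = p + q + 2)%N by lia.
have -> : (j.+1 - i.+1 = q + r + 2)%N by lia.
have -> : (j.+1 - x = p + q + r + 3)%N by lia.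
have -> : (j1.+1 - i.+1 = q.+1)%N by lia.
have -> : (i.+1 - x = p.+1)%N by lia.
have -> : (j.+1 - j1.+1 = r.+1)%N by lia.
have pr : (0 < 2 * (p.+1 * r.+1))%N by rewrite !muln_gt0.
split; first apply: (@leq_trans (((p + q + 2) ^ 2 + (q + r + 2) ^ 2) +
  2 * (p.+1 * r.+1))%N).
- by rewrite -[X in (X < _)%N]addn0 ltn_add2l.
- by rewrite leq_eqVlt; apply/orP; left; apply/eqP; ring.
apply: (@leq_trans ((p.+1 ^ 2 + r.+1 ^ 2) + 2 * (p.+1 * r.+1) +
  2 * (q.+1 * (p + q + r + 3)))%N).
- by rewrite -addnA -[X in (X < _)%N]addn0 ltn_add2l addn_gt0 pr.
- by rewrite leq_eqVlt; apply/orP; left; apply/eqP; ring.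
Qed.

Lemma straightening S k l : subspace S ->
  (forall s, standard s -> nvar s = k -> nminor s = l -> S (gen_prod s)) ->
  forall s, all increasing s -> nvar s = k -> nminor s = l -> S (gen_prod s).
Proof.
move=> sS Sstd s; have [r] := ubnP (spread s).
elim: r s => // r IH s; rewrite ltnS => sr incs sk sl.
have [std|] := pselect (standard s); first exact: Sstd.
rewrite /standard => nstd.
have [c cs [d ds cd]] : exists2 c, c \in s & exists2 d, d \in s & nested c d.
  apply: contrapT => no; apply: nstd; split=> // c d cs ds; apply/negP => cd.
  by apply: no; exists c => //; exists d.
have dc : d \in rem c s.
  have := perm_to_rem cs; move/perm_mem/(_ d); rewrite ds inE.
  case: eqP cd => [->|//]; by rewrite /nested ltnn.
have {dc} P : perm_eq s [:: c, d & rem d (rem c s)].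
  by rewrite (perm_trans (perm_to_rem cs)) // perm_cons perm_to_rem.
move: (rem _ _) P => u P.
have -> : gen_prod s = gen_prod [:: c, d & u] by apply: perm_big.
have incu : all increasing [:: c, d & u] by rewrite -(perm_all _ P).
have spu : spread s = spread [:: c, d & u] by apply: perm_big.
move: sk sl; rewrite /nvar /nminor !(seq.permP P) /=.
(* The inner element [d] is a minor, since the first index 0 of a variable exceeds no other; so the
   relation [plucker] applies. *)
case: c d cd incu spu {P cs ds} => [o j] [[i1|] j1]; last by rewrite /nested ltn0.
rewrite /nested /= => /andP[oi1 j1j] /and3P[incc incd incu] spu sk sl.
rewrite /increasing /= in incc incd.
rewrite !gen_prod_cons mulrA plucker mulrBl -!mulrA -!gen_prod_cons.
have [lt1 lt2] := spread_decreases oi1 incd j1j.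
have ltxj w : (i1 <= w)%N -> (fst_idx (o, j) < w.+1)%N.
  by move=> i1w; apply: leq_trans oi1 _.
apply: (subspaceB sS); apply: IH => //=.
- apply: leq_trans sr; rewrite spu /spread !big_cons !addnA ltn_add2r.
  exact: lt1.
- by rewrite incu [X in X && _]ltxj 1?ltnW //= andbT; apply: ltn_trans j1j.
- apply: leq_trans sr; rewrite spu /spread !big_cons !addnA ltn_add2r.
  exact: lt2.
- by rewrite incu [X in X && _]ltxj //= andbT; apply: j1j.
Qed.

Lemma gen_increasing c : exists z d,
  [/\ increasing d, (d.1 == None) = (c.1 == None) & gen c = z *: gen d].
Proof.
case: c => [[i|] j]; last by exists 1, (None, j); rewrite scale1r.
have [ij|ji|ij] := ltngtP i j.
- by exists 1, (Some i, j); rewrite scale1r.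
- exists (- 1), (Some j, i); split=> //.
  by rewrite /gen /= scaleN1r -scalerN opprB.
(* The minor is zero; an increasing one with coefficient 0 stands in for it, to keep the number of
   minors. *)
- exists 0, (Some prv, lst); split=> //.
    by rewrite /increasing /fst_idx /= ltnS prv_lst.
  by rewrite /gen /= (val_inj ij) subrr scaler0 scale0r.
Qed.

Lemma gen_prod_increasing s : exists z t,
  [/\ all increasing t, nvar t = nvar s, nminor t = nminor s &
      gen_prod s = z *: gen_prod t].
Proof.
elim: s => [|c s [z [t [inct tk tl tE]]]]; first by exists 1, [::]; rewrite scale1r.
have [y [d [incd dc cE]]] := gen_increasing c.
exists (y * z), (d :: t); rewrite /nvar /nminor /= in tk tl *.
rewrite incd dc tk tl inct.
by split=> //; rewrite !gen_prod_cons cE tE -scalerAl -scalerAr scalerA.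
Qed.

(** * Leading monomials and linear independence *)

Definition below w f : Prop := forall m, m \in msupp f -> (wt a val m < w)%N.

Lemma below_subspace w : subspace (below w).
Proof.
split=> [m|z f g fw gw m]; first by rewrite msupp0.
by move=> /msuppD_le; rewrite mem_cat => /orP[/msuppZ_le/fw|/gw].
Qed.

(** The sum of the [a]-indices only preorders monomials, so the leading one is required to exceed
    all others strictly; this passes to products. *)
Definition has_top m f : Prop := exists z g,
  [/\ z != 0, below (wt a val m) g & f = z *: 'X_[m] + g].

Lemma has_top_mcoeff m f : has_top m f -> f@_m != 0.
Proof.
move=> [z [g [zn0 gm ->]]]; rewrite mcoeffD mcoeffZ mcoeffX eqxx mulr1.
by rewrite (@memN_msupp_eq0 _ _ g m) ?addr0 //; apply/negP => /gm; rewrite ltnn.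
Qed.

Lemma has_top_msupp m f m' : has_top m f -> m' \in msupp f ->
  m' != m -> (wt a val m' < wt a val m)%N.
Proof.
move=> [z [g [zn0 gm ->]]] /msuppD_le; rewrite mem_cat => /orP[|/gm //].
by move/msuppZ_le; rewrite msuppX inE => /eqP ->; rewrite eqxx.
Qed.

Lemma has_topM m m' f f' : has_top m f -> has_top m' f' ->
  has_top (m + m')%MM (f * f').
Proof.
move=> [z [g [zn0 gm ->]]] [z' [g' [z'n0 g'm ->]]].
exists (z * z'), (z *: 'X_[m] * g' + g * (z' *: 'X_[m'] + g')).
split; first by rewrite mulf_neq0.
  have sb := below_subspace (wt a val (m + m')%MM).
  apply: (subspaceD sb); rewrite -?scalerAl.
    apply: (subspaceZ sb) => k /msuppM_le/allpairsP[[k1 k2] /= [+ /g'm k2m ->]].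
    by rewrite msuppX inE => /eqP ->; rewrite !wtD ltn_add2l.
  move=> k /msuppM_le/allpairsP[[k1 k2] /= [/gm k1m + ->]].
  move/msuppD_le; rewrite mem_cat !wtD => /orP[/msuppZ_le|/g'm k2m].
    by rewrite msuppX inE => /eqP ->; rewrite ltn_add2r.
  by rewrite -addSn; apply: leq_add => //; apply: ltnW.
rewrite mpolyXD mulrDl -scalerA addrA; congr (_ + _).
by rewrite mulrDr -scalerAl -scalerAr scalerA.
Qed.

Lemma has_top1 : has_top 0%MM 1.
Proof.
exists 1, 0; rewrite oner_neq0 scale1r addr0 mpolyX0; split=> //.
by case: (below_subspace (wt a val 0%MM)).
Qed.

(** In a minor with [i < j] the term with the larger index on the [a] side leads. Hence in a product
    the exponents on the [a] side count second indices, and those on the [b] side first indices. *)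
Definition gen_top c : 'X_{1..N} :=
  if c.1 is Some i then (U_(a c.2) + U_(b i))%MM else U_(a c.2)%MM.

Definition gen_prod_top s : 'X_{1..N} := (\sum_(c <- s) gen_top c)%MM.

Lemma has_top_gen c : increasing c -> has_top (gen_top c) (gen c).
Proof.
case: c => [[i|] j]; rewrite /increasing /fst_idx /gen_top /gen /=; last first.
  move=> _; exists 1, 0; rewrite oner_neq0 scale1r addr0; split=> //.
  by case: (below_subspace (wt a val U_(a j)%MM)).
rewrite ltnS => ij; exists (- eps), (eps *: ('X_(a i) * 'X_(b j))).
split; first by rewrite oppr_eq0.
  move=> m /msuppZ_le; rewrite -mpolyXD msuppX inE => /eqP ->.
  case: (wtU val i) (wtU val j) => ai bi _ _ [aj bj _ _].
  by rewrite !wtD ai bi aj bj !addn0.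
by rewrite scalerBr scaleNr [RHS]addrC -!mpolyXD.
Qed.

Lemma has_top_gen_prod s : all increasing s ->
  has_top (gen_prod_top s) (gen_prod s).
Proof.
rewrite /gen_prod_top; elim: s => [|c s IH] /=.
  by rewrite /gen_prod !big_nil => _; apply: has_top1.
move=> /andP[ic /IH sT]; rewrite gen_prod_cons big_cons.
by apply: has_topM sT; apply: has_top_gen.
Qed.

Lemma gen_prod_topE s j :
  gen_prod_top s (a j) = count (fun c => c.2 == j) s /\
  gen_prod_top s (b j) = count (fun c => c.1 == Some j) s.
Proof.
rewrite /gen_prod_top; elim: s => [|c s [IHa IHb]]; first by rewrite big_nil !mnm0E.
rewrite big_cons !mnmDE IHa IHb /=.
have ba i k : (b i == a k) = false by rewrite eq_sym (negbTE (ab_neq _ _)).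
case: c => [[i|] k]; rewrite /gen_top /= ?mnmDE !mnm1E ?(inj_eq a_inj)
  ?(inj_eq b_inj) ?(negbTE (ab_neq _ _)) ?ba ?addn0 ?add0n //.
Qed.

(** The leading monomial gives both marginals of the multiset of index pairs, except for the number
    of missing first indices, which [nvar] supplies; without nesting the marginals determine it. *)
Lemma standard_perm s t : standard s -> standard t -> nvar s = nvar t ->
  gen_prod_top s = gen_prod_top t -> perm_eq s t.
Proof.
move=> [incs nns] [inct nnt] vst top_st.
have P1 : perm_eq (map fst s) (map fst t).
  apply/allP => o _ /=; rewrite !count_map; apply/eqP.
  case: o => [i|]; last exact: vst.
  by rewrite -[LHS](gen_prod_topE s i).2 -[RHS](gen_prod_topE t i).2 top_st.
have P2 : perm_eq (map snd s) (map snd t).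
  apply/allP => j _ /=; rewrite !count_map; apply/eqP.
  by rewrite -[LHS](gen_prod_topE s j).1 -[RHS](gen_prod_topE t j).1 top_st.
apply: (@nonnested_perm _ fst_idx (fun c => val c.2)) => //.
- by move=> [[i|] j] [[k|] l] //= [] => [/val_inj -> /val_inj ->|/val_inj ->].
- by have := perm_map (oapp (fun i : 'I_n => i.+1) 0%N) P1; rewrite -!map_comp.
- by have := perm_map val P2; rewrite -!map_comp.
Qed.

Lemma standard_poly_indep k l : lin_indep (standard_poly k l).
Proof.
move=> r c ur rS c0 u ur'; apply/eqP; apply: contraT => cu.
have topP f : standard_poly k l f -> exists s,
    [/\ standard s, nvar s = k, f = gen_prod s & has_top (gen_prod_top s) f].
  move=> [s [ss sk sl fE]]; exists s; split=> //; rewrite fE.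
  by apply: has_top_gen_prod; case: ss.
(* [top f] is the leading monomial of some standard list for [f], with 0 as default value for other
   polynomials. *)
pose top f := if pselect (standard_poly k l f) is left H
  then gen_prod_top (projT1 (cid (topP f H))) else 0%MM.
have top_has f : standard_poly k l f -> has_top (top f) f.
  by move=> fS; rewrite /top; case: pselect => // H; case: cid => s [].
have top_inj f g : standard_poly k l f -> standard_poly k l g -> top f = top g -> f = g.
  move=> fS gS; rewrite /top; case: pselect => // H; case: pselect => // H'.
  case: cid => s [ss sk fE sT]; case: cid => t [st tk gE tT] /= E.
  by rewrite fE gE; apply: perm_big; apply: standard_perm => //; rewrite sk.
have ur0 : u \in [seq f <- r | c f != 0] by rewrite mem_filter cu.
have [|f] := @seq_argmax _ (fun f => wt a val (top f)) [seq f <- r | c f != 0].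
  by move=> E; rewrite E in ur0.
rewrite mem_filter => /andP[cf fr] fmax.
(* [f] has the largest leading weight among the terms with nonzero coefficient. Another such [g] has
   a different leading monomial, and its other monomials weigh strictly less, so [top f] occurs in
   [f] alone. *)
have := congr1 (mcoeff (top f)) c0.
rewrite mcoeff0 (bigD1_seq f) //= mcoeffD mcoeffZ.
rewrite [X in _ + X]raddf_sum big1_seq /= => [|g /andP[gf gr]].
  rewrite addr0 => /eqP; rewrite mulf_eq0 (negbTE cf) /=.
  by rewrite (negbTE (has_top_mcoeff (top_has _ (rS _ fr)))).
rewrite mcoeffZ; have [->|cg] := eqVneq (c g) 0; first by rewrite mul0r.
rewrite memN_msupp_eq0 ?mulr0 //; apply/negP => /(has_top_msupp (top_has _ (rS _ gr))).
have /[swap] /[apply] : top f != top g.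
  by apply: contra_neq gf => /top_inj ->//; apply: rS.
by rewrite ltnNge fmax // mem_filter cg.
Qed.

Lemma standard_poly_Hker k l f : standard_poly k l f -> Hker (k + l)%N%:Z l%:Z f.
Proof. by move=> [s [_ <- <- ->]]; apply: Hker_gen_prod. Qed.

(** * The highest weight vector, its weight, and the basis *)

Definition top_vector k l : B := 'X_(a lst) ^+ k * gen (Some prv, lst) ^+ l.

Lemma top_vectorE k l : exists s,
  [/\ nvar s = k, nminor s = l & top_vector k l = gen_prod s].
Proof.
exists (nseq k (None, lst) ++ nseq l (Some prv, lst)).
rewrite /nvar /nminor !count_cat !count_nseq /= !mul1n !mul0n addn0; split=> //.
by rewrite /gen_prod big_cat !big_nseq !iter_mulr_1.
Qed.

Lemma top_vector_Hker k l : Hker (k + l)%N%:Z l%:Z (top_vector k l).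
Proof. by have [s [<- <- ->]] := top_vectorE k l; apply: Hker_gen_prod. Qed.

Lemma top_vector_neq0 k l : top_vector k l <> 0.
Proof.
apply/eqP; rewrite mulf_neq0 ?expf_neq0 //.
  by rewrite -msupp_eq0 msuppX.
have /has_top_gen/has_top_mcoeff : increasing (Some prv, lst).
  by rewrite /increasing /fst_idx /= ltnS prv_lst.
by apply: contra_neq => ->; rewrite mcoeff0.
Qed.

Lemma highest_top_vector k l : highest (top_vector k l).
Proof.
move=> i j ij; have dD := derivation_D i j.
(* Vanishing is stated as an eigenvalue 0 so that [deriv_eigenX] yields it for powers. On the minor
   only [i = prv], [j = lst] could act, and this repeats an index. *)
have Dvar : D i j 'X_(a lst) = 0 *: 'X_(a lst).
  rewrite D_a; case: eqP ij => [->|_]; last by rewrite !scale0r.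
  by have := ltn_ord j; rewrite lstE; lia.
have Dmin : D i j (gen (Some prv, lst)) = 0 *: gen (Some prv, lst).
  rewrite D_gen_minor scale0r; have [il|il] := eqVneq i lst.
    by move: ij; rewrite il; have := ltn_ord j; rewrite lstE; lia.
  rewrite scale0r addr0; have [ip|ip] := eqVneq i prv; last by rewrite scale0r.
  have -> : j = lst.
    by apply: val_inj => /=; move: ij; have := ltn_ord j; rewrite ip lstE prvE; lia.
  by rewrite scale1r /gen /= subrr scaler0.
rewrite /top_vector dD.2 (deriv_eigenX dD _ Dvar) (deriv_eigenX dD _ Dmin).
by rewrite !mul0rn !scale0r mul0r mulr0 addr0.
Qed.

Lemma D_top_vector i k l : D i i (top_vector k l) =
  (k * (i == lst) + l * ((i == lst) + (i == prv)))%N%:R *: top_vector k l.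
Proof.
have dD := derivation_D i i.
have Dvar : D i i 'X_(a lst) = (i == lst)%:R *: 'X_(a lst).
  by rewrite D_a; case: eqP => [->|_] //; rewrite !scale0r.
have Dmin : D i i (gen (Some prv, lst)) =
    ((i == lst) + (i == prv))%N%:R *: gen (Some prv, lst).
  rewrite D_gen_minor natrD scalerDl addrC.
  by congr (_ + _); case: eqP => [->|_] //; rewrite !scale0r.
rewrite /top_vector dD.2 (deriv_eigenX dD _ Dvar) (deriv_eigenX dD _ Dmin).
rewrite -scalerAl -scalerAr -scalerDl -![_%:R *+ _]mulrnA -natrD.
by rewrite mulnC [(_ * l)%N]mulnC.

Qed.

Lemma irreducible_Hker_top k l : irreducible_module gact (Hker (k + l)%N%:Z l%:Z).
Proof.
exact: (irreducible_Hker (top_vector_Hker k l) (@highest_top_vector k l)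
  (@top_vector_neq0 k l)).
Qed.

Lemma standard_poly_basis k l :
  is_basis (standard_poly k l) (Hker (k + l)%N%:Z l%:Z).
Proof.
have sH := Hker_subspace (k + l)%N%:Z l%:Z.
split=> [|f]; first exact: standard_poly_indep.
split=> [fH|]; last first.
  by apply: lin_span_min => // g; apply: standard_poly_Hker.
have sS := lin_span_subspace (standard_poly k l).
(* [prod_span k l] is a submodule that contains the generator [top_vector k l], so it contains the
   kernel. *)
have [_ gen_top_v] := irreducible_generated (irreducible_Hker_top k l)
  (top_vector_Hker k l) (@top_vector_neq0 k l).
have : prod_span k l f.
  apply: gen_top_v fH; first exact: prod_span_submodule.
  by have [s [sk sl ->]] := top_vectorE k l; apply: prod_span_prod.
apply: lin_span_min => // _ [s [sk sl ->]].
have [z [t [inct tk tl ->]]] := gen_prod_increasing s.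
apply: (subspaceZ sS).
have St := @straightening _ k l sS _ t inct.
apply: St; rewrite ?tk ?tl // => t' st' t'k t'l.
by apply: lin_span_incl; exists t'.
Qed.

Lemma sum_coroot (w : nat -> C) (i : nat) : (i.+1 < n)%N ->
  \sum_(s < n) coroot C n i.+1 s s * w s = w i - w i.+1.
Proof.
move=> Hi; have Hi' := ltnW Hi.
under eq_bigr => s _ do rewrite !mxE eqxx mulr1n eqSS mulrBl.
rewrite sumrB; congr (_ - _).
  rewrite (bigD1 (Ordinal Hi')) //= eqxx mul1r big1 ?addr0 // => s.
  by rewrite -val_eqE /= => /negbTE ->; rewrite mul0r.
rewrite (bigD1 (Ordinal Hi)) //= eqxx mul1r big1 ?addr0 // => s.
by rewrite -val_eqE /= => /negbTE ->; rewrite mul0r.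
Qed.

Lemma gact_coroot_top_vector (i : nat) k l : (i.+1 < n)%N ->
  gact (coroot C n i.+1) (top_vector k l) =
  (l * (n - 2 == i.+1) + k * (n - 1 == i.+1))%N%:R *: top_vector k l.
Proof.
move=> Hi; have trE : \tr (coroot C n i.+1) = 0.
  rewrite /mxtrace -[RHS](subrr (1 : C)) -(sum_coroot (fun=> 1) Hi).
  by apply: eq_bigr => s _; rewrite mulr1.
rewrite gact_sl //.
(* The eigenvalue of [D s s]. The minus sign of [gact] turns the pairing with a coroot into
   [w i.+1 - w i], which is [l] when [i.+1] is [n.-2], [k] when it is [n.-1], and 0 otherwise. For
   [n = 2] only the second occurs, in accordance with $\lambda_0=0$. *)
pose w (s : nat) : C := (k * (s == n.-1) + l * ((s == n.-1) + (s == n.-2)))%N%:R.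
have -> : \sum_s \sum_t coroot C n i.+1 s t *: D s t (top_vector k l) =
    (\sum_(s < n) coroot C n i.+1 s s * w s) *: top_vector k l.
  rewrite scaler_suml; apply: eq_bigr => s _.
  rewrite (bigD1 s) //= big1 ?addr0 => [|t ts].
    by rewrite D_top_vector scalerA /w -!val_eqE lstE prvE.
  by rewrite mxE eq_sym (negbTE ts) mulr0n scale0r.
rewrite sum_coroot // -scaleNr opprB /w; congr (_ *: _).
have [j nE] : exists j, n = (i + j).+2 by exists (n - i.+2)%N; lia.
have -> : (i == n.-1) = false by lia.
have -> : (n - 2 == i.+1)%N = (i.+1 == n.-2) by lia.
have -> : (n - 1 == i.+1)%N = (i.+1 == n.-1) by lia.
have -> : (i == n.-2) = (i.+1 == n.-1) by lia.
rewrite -natrB; last by case: (i.+1 == n.-1); case: (i.+1 == n.-2); lia.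
by congr (_%:R); case: (i.+1 == n.-1); case: (i.+1 == n.-2); lia.
Qed.

Lemma top_vector_weight k l (h : 'M[C]_n) : h \in cartan C n ->
  gact h (top_vector k l) =
  (l%:R * fweight (n - 2) h + k%:R * fweight (n - 1) h) *: top_vector k l.
Proof.
move=> hH; rewrite {1}(coord_span hH) gact_suml.
have -> : l%:R * fweight (n - 2) h + k%:R * fweight (n - 1) h =
    \sum_(i < n.-1) coord (coroots C n) i h *
      (l * (n - 2 == i.+1) + k * (n - 1 == i.+1))%N%:R.
  rewrite /fweight !mulr_sumr !(big_mkcond (fun i : 'I_n.-1 => i.+1 == _)) -big_split.
  apply: eq_bigr => i _ /=; rewrite natrD !natrM mulrDr ![_ == i.+1]eq_sym.
  by congr (_ + _); case: eqP => _; rewrite ?mulr0 // mulr1 mulrC.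
rewrite scaler_suml; apply: eq_bigr => i _.
rewrite gactZl (nth_mktuple (fun k : 'I_n.-1 => coroot C n k.+1)).
rewrite gact_coroot_top_vector ?scalerA //.
by have := ltn_ord i; lia.
Qed.

Lemma top_vector_pos_nilp k l (e : 'M[C]_n) : e \in pos_nilp C n ->
  gact e (top_vector k l) = 0.
Proof.
move=> /memv_sumP[f fV ->]; rewrite gact_suml big1 // => i _.
have /memv_sumP[g gV ->] := fV i isT; rewrite gact_suml big1 // => j ij.
have /vlineP[z ->] := gV j ij; rewrite gactZl gact_delta ?neq_ltn ?ij //.
by rewrite highest_top_vector // oppr0 scaler0.
Qed.

(** [mu] is a parameter because the two cases of the theorem write the weight differently. *)
Lemma top_vector_highest_weight k l (mu : 'M[C]_n -> C) :
  (forall h : 'M[C]_n, mu h = l%:R * fweight (n - 2) h + k%:R * fweight (n - 1) h) ->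
  highest_weight_module gact (Hker (k + l)%N%:Z l%:Z) mu (top_vector k l).
Proof.
move=> muE; split; first exact: Hker_submodule.
  exact: (irreducible_generated (irreducible_Hker_top k l)
    (top_vector_Hker k l) (@top_vector_neq0 k l)).
split=> [|h hH|e eN]; first exact: top_vector_neq0.
  by rewrite muE top_vector_weight.
exact: top_vector_pos_nilp.
Qed.

(** * From lists of generators to exponents *)

Lemma gen_prod_count s : all increasing s -> gen_prod s =
  \prod_t gen (None, t) ^+ count_mem (None, t) s *
  \prod_(i < n) \prod_(j < n | (i < j)%N) gen (Some i, j) ^+ count_mem (Some i, j) s.
Proof.
move=> incs; rewrite /gen_prod prodr_count big_option_pair; congr (_ * _).
apply: eq_bigr => i _; rewrite [RHS]big_mkcond; apply: eq_bigr => j _.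
case: ifP => // ij; rewrite (count_memPn _) ?expr0 //.
by apply/negP => /(allP incs); rewrite /increasing /= ltnS ij.
Qed.

Lemma nvar_count s : nvar s = (\sum_(t < n) count_mem (None, t) s)%N.
Proof.
rewrite /nvar sum_count big_option_pair /= [X in (_ + X)%N]big1 => [|i _].
  by rewrite addn0; apply: eq_bigr => t _; rewrite mul1n.
by rewrite big1 // => j _; rewrite mul0n.
Qed.

Lemma nminor_count s : all increasing s -> nminor s =
  (\sum_(i < n) \sum_(j < n | (i < j)%N) count_mem (Some i, j) s)%N.
Proof.
move=> incs; rewrite /nminor sum_count big_option_pair /= big1 ?add0n //.
apply: eq_bigr => i _; rewrite [RHS]big_mkcond; apply: eq_bigr => j _.
rewrite mul1n; case: ifP => // ij; apply/count_memPn.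
by apply/negP => /(allP incs); rewrite /increasing /= ltnS ij.
Qed.

Lemma standard_polyE k l f : standard_poly k l f <->
  exists (K0 : 'I_n -> nat) (K : 'I_n -> 'I_n -> nat),
    [/\ (\sum_(i < n) \sum_(j < n | (i < j)%N) K i j)%N = l,
        (\sum_(t < n) K0 t)%N = k,
        forall i j t : 'I_n, (i < j)%N -> (j < t)%N -> (K i j * K0 t)%N = 0%N,
        forall i j i1 j1 : 'I_n, (i < j)%N -> (i1 < j1)%N ->
          (i < i1)%N -> (j1 < j)%N -> (K i j * K i1 j1)%N = 0%N
      & f = \prod_(t < n) gen (None, t) ^+ K0 t *
            \prod_(i < n) \prod_(j < n | (i < j)%N) gen (Some i, j) ^+ K i j].
Proof.
split=> [[s [[incs nns] sk sl ->]]|[K0 [K [Kl K0k KK0 KK ->]]]].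
  exists (fun t : 'I_n => count_mem (None, t) s), (fun i j => count_mem (Some i, j) s).
  have count0 c d : nested c d -> (count_mem c s * count_mem d s)%N = 0%N.
    move=> cd; have [cs|/count_memPn ->] := boolP (c \in s); last by rewrite mul0n.
    rewrite (count_memPn _ : count_mem d s = 0%N) ?muln0 //.
    by apply/negP => ds; move: (nns c d cs ds); rewrite cd.
  split.
  - by rewrite -nminor_count.
  - by rewrite -nvar_count.
  - by move=> i j t ij jt; rewrite mulnC count0.
  - by move=> i j i1 j1 ij ij1 ii1 j1j; rewrite count0 // /nested /= ltnS ii1.
  - exact: gen_prod_count.
(* [K] is constrained only for [i < j]; the value 0 elsewhere makes every generator in the list
   increasing. *)
pose Kc c := if c.1 is Some i then if (i < c.2)%N then K i c.2 else 0%N else K0 c.2.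
have [s sK] := exists_count_mem Kc.
have sP c : c \in s -> Kc c <> 0%N by rewrite -sK => cs /count_memPn; rewrite cs.
have incs : all increasing s.
  apply/allP => -[[i|] j] /sP //; rewrite /Kc /increasing /= ltnS.
  by case: ifP.
have nns : {in s &, forall c d, ~~ nested c d}.
  move=> c d /sP + /sP; case: d => [[i1|] j1]; last by rewrite /nested ltn0.
  case: c => [[i|] j]; rewrite /Kc /nested /=; case: ifP => // ij.
    case: ifP => // ij1; move=> /eqP Ki /eqP K1; apply/andP => -[ii1 j1j].
    by have /eqP := KK i j i1 j1 ij ij1 ii1 j1j; rewrite muln_eq0 (negbTE Ki) (negbTE K1).
  move=> /eqP Ki /eqP K1; apply/negP => j1j.
  by have /eqP := KK0 i1 j1 j ij j1j; rewrite muln_eq0 (negbTE K1) (negbTE Ki).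
exists s; split=> //.
- by rewrite nvar_count -K0k; apply: eq_bigr => t _; rewrite sK.
- rewrite nminor_count // -Kl; apply: eq_bigr => i _; apply: eq_bigr => j ij.
  by rewrite sK /Kc /= ij.
rewrite gen_prod_count //; congr (_ * _); apply: eq_bigr => i _; first by rewrite sK.
by apply: eq_bigr => j ij; rewrite sK /Kc /= ij.
Qed.

End Bigraded.

(** * Exchange of the two groups, and transfer to the given operators *)

Lemma gactC (C : numClosedFieldType) (n N : nat) (a b : 'I_n -> 'I_N) :
  @gact C n N a b = gact b a.
Proof.
have DC i j f : @D C n N a b i j f = D b a i j f by rewrite /D addrC.
apply/funext => A; apply/funext => f; rewrite /gact.
by under eq_bigr => i _ do under eq_bigr => j _ do rewrite DC.
Qed.

(** Exchanging the two rows of a minor changes its sign, which [eps = -1] compensates. *)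
Lemma gen_swap (C : numClosedFieldType) (n N : nat) (a b : 'I_n -> 'I_N) i j :
  @gen C n N a b 1 (Some i, j) = gen b a (- 1) (Some i, j).
Proof.
by rewrite /gen /= scale1r scaleN1r opprB ['X_(b j) * _]mulrC ['X_(b i) * _]mulrC.
Qed.

Lemma DeN (C : numClosedFieldType) (n N : nat) (a b : 'I_n -> 'I_N) f :
  @De C n N a b (- f) = - De a b f.
Proof.
by rewrite -[- f]scaleN1r (derivZ (derivation_De C a b)) scaleN1r.
Qed.

Section Transfer.
Variables (R : realType) (n : nat).
Local Notation C := R[i].
Local Notation B := {mpoly C[n + n]}.
Local Notation xi := (@lshift n n).
Local Notation yi := (@rshift n n).

Lemma sum_shift (G : 'I_(n + n) -> nat) :
  (\sum_k G k = \sum_i G (xi i) + \sum_i G (yi i))%N.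
Proof. exact: big_split_ord. Qed.

Lemma sum_shift_swap (G : 'I_(n + n) -> nat) :
  (\sum_k G k = \sum_i G (yi i) + \sum_i G (xi i))%N.
Proof. by rewrite sum_shift addnC. Qed.

Lemma xi_neq_yi i j : xi i != yi j.
Proof. by rewrite eq_lrshift. Qed.

Lemma yi_neq_xi i j : yi i != xi j.
Proof. by rewrite eq_sym xi_neq_yi. Qed.

Lemma mpolyX_shift (m : 'X_{1..n + n}) : 'X_[m] =
  \prod_(i < n) xvar R i ^+ m (xi i) * \prod_(i < n) yvar R i ^+ m (yi i).
Proof. by rewrite mpolyXE_id big_split_ord. Qed.

Lemma BhomE l1 l2 : @Bhom R n l1 l2 = bihom xi yi (- l1) l2.
Proof.
apply/funext => f; apply/propext; split.
  apply: lin_span_min; first exact: bihom_subspace.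
  move=> _ [al [be [alE beE ->]]] m; pose m0 := [multinom if split k is inl i then al i else
    if split k is inr i then be i else 0%N | k < n + n].
  have m0x i : m0 (xi i) = al i by rewrite mnmE (unsplitK (inl i)).
  have m0y i : m0 (yi i) = be i by rewrite mnmE (unsplitK (inr i)).
  have -> : \prod_(i < n) xvar R i ^+ al i * \prod_(i < n) yvar R i ^+ be i =
      'X_[m0].
    by rewrite mpolyX_shift; congr (_ * _); apply: eq_bigr => i _; rewrite ?m0x ?m0y.
  rewrite msuppX inE => /eqP ->; rewrite -alE -beE.
  by split; congr (Posz _); apply: eq_bigr => i _; rewrite ?m0x ?m0y mul1n.
move=> fB; rewrite [f]mpolyE big_seq.
apply: (subspace_sum (lin_span_subspace _)) => m /fB[mx my].
apply: (subspaceZ (lin_span_subspace _)); apply: lin_span_incl.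
exists (fun i => m (xi i)), (fun i => m (yi i)); split; last exact: mpolyX_shift.
- by rewrite -mx; congr (Posz _); apply: eq_bigr => i _; rewrite mul1n.
- by rewrite -my; congr (Posz _); apply: eq_bigr => i _; rewrite mul1n.
Qed.

Lemma bihomC p q : @bihom C n _ xi yi p q = bihom yi xi q p.
Proof.
by apply/funext => f; apply/propext; split=> fB m /fB[].
Qed.

Lemma mxactE : @mxact R n = gact xi yi.
Proof.
apply/funext => A; apply/funext => f; rewrite /mxact /gact /mxtrace -sumrN.
rewrite scaler_suml -sumrB; apply: eq_bigr => i _.
have -> : A i i *: f = \sum_j A i j *: ((i == j)%:R * f).
  rewrite (bigD1 i) //= eqxx mul1r big1 ?addr0 // => j ji.
  by rewrite eq_sym (negbTE ji) mul0r scaler0.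
rewrite -sumrN -sumrB; apply: eq_bigr => j _.
rewrite -scalerN -scalerBr /Eact /D /xd /dx /dy /xvar /yvar; congr (_ *: _); ring.
Qed.

Lemma DeltaBE : @DeltaB R n = fun f => - De xi yi f.
Proof. by []. Qed.

(** [DeltaB] is the negative of [Deta yi xi], and a subspace is stable under negation. *)
Lemma im_DeltaB (M : B -> Prop) : subspace M ->
  im_of (@DeltaB R n) M = im_of (Deta yi xi) M.
Proof.
move=> sM; apply/funext => f; apply/propext; rewrite DeltaBE (_ : Deta yi xi = De xi yi) //.
have DN g : De xi yi (- g) = - De xi yi g by exact: DeN.
split=> -[g Mg ->]; exists (- g); rewrite ?DN ?opprK //; exact: subspaceN.
Qed.

Lemma standard_productE (a b : 'I_n -> 'I_(n + n)) eps z k l :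
  (forall t, z t = 'X_(a t)) -> (forall i j, minor R i j = gen a b eps (Some i, j)) ->
  standard_product z k%:Z l%:Z = standard_poly a b eps k l.
Proof.
move=> zE mE; apply/funext => f; apply/propext; rewrite standard_polyE.
have Ez K0 : \prod_(t < n) z t ^+ K0 t = \prod_(t < n) gen a b eps (None, t) ^+ K0 t.
  by apply: eq_bigr => t _; rewrite zE.
have Em K : \prod_(i < n) \prod_(j < n | (i < j)%N) minor R i j ^+ K i j =
    \prod_(i < n) \prod_(j < n | (i < j)%N) gen a b eps (Some i, j) ^+ K i j.
  by apply: eq_bigr => i _; apply: eq_bigr => j _; rewrite mE.
split=> -[K0 [K [Kl K0k KK0 KK ->]]]; exists K0, K; rewrite Ez Em.
  by split=> //; [case: Kl | case: K0k].
by rewrite Kl K0k.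
Qed.

Lemma minor_xy i j : minor R i j = gen xi yi 1 (Some i, j).
Proof. by rewrite /gen /= scale1r. Qed.

Lemma minor_yx i j : minor R i j = gen yi xi (- 1) (Some i, j).
Proof.
by rewrite minor_xy gen_swap.
Qed.

End Transfer.

Theorem theorem5p2 (R : realType) (n : nat) (hn : (1 < n)%N)
    (l1 l2 : int) (hl1 : l1 <= 0) (hl2 : 0 <= l2) :
  let act := @mxact R n in
  let x := @xvar R n in
  let y := @yvar R n in
  let u := minor R (ord_n1 hn) (ord_n hn) in
  let lambda := @fweight R[i] n in
  (l1 + l2 <= 0 ->
    [/\ is_direct_sum (@Bhom R n l1 l2) (Hhom l1 l2)
          (im_of (@etaB R n) (Bhom (l1 - 1) (l2 - 1))),
        irreducible_module act (Hhom l1 l2),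
        highest_weight_module act (Hhom l1 l2)
          (fun h => l2%:~R * lambda (n - 2)%N h
                    - (l1 + l2)%:~R * lambda (n - 1)%N h)
          (x (ord_n hn) ^+ absz (- l1 - l2)%R * u ^+ absz l2)
      & is_basis (standard_product x (- l1 - l2) l2) (Hhom l1 l2)])
  /\
  (0 < l1 + l2 ->
    [/\ is_direct_sum (@Bhom R n l1 l2) (Hhom' l1 l2)
          (im_of (@DeltaB R n) (Bhom (l1 + 1) (l2 + 1))),
        irreducible_module act (Hhom' l1 l2),
        highest_weight_module act (Hhom' l1 l2)
          (fun h => (- l1)%:~R * lambda (n - 2)%N h
                    + (l1 + l2)%:~R * lambda (n - 1)%N h)
          (y (ord_n hn) ^+ absz (l1 + l2)%R * u ^+ absz l1)
      & is_basis (standard_product y (l1 + l2) (- l1)) (Hhom' l1 l2)]).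
Proof.
move=> act x y u lambda.
have xI := @lshift_inj n n; have yI := @rshift_inj n n.
have nE : val (ord_n hn) = n.-1 by [].
have pE : val (ord_n1 hn) = n.-2 by [].
split=> [l12|l12].
  (* Here [k] counts variables and [l] minors; the x-degree is $-l_1=k+l$ and the y-degree is
     $l_2=l$. *)
  have [[k kE] [l lE]] : (exists k : nat, - l1 - l2 = k) /\ (exists l : nat, l2 = l).
    by split; [exists (absz (- l1 - l2)) | exists (absz l2)]; lia.
  have p1 : - l1 = (k + l)%N%:Z by lia.
  have HE : @Hhom R n l1 l2 = Hker (@lshift n n) (@rshift n n) (k + l)%N%:Z l%:Z.
    apply/funext => f; apply/propext; rewrite /Hhom BhomE /Hker DeltaBE.
    rewrite p1 lE.
    by split=> -[fB /eqP f0]; split=> //; apply/eqP; move: f0; rewrite oppr_eq0.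
  have uE : x (ord_n hn) ^+ absz (- l1 - l2)%R * u ^+ absz l2 =
      top_vector (@lshift n n) (@rshift n n) (ord_n hn) (ord_n1 hn) 1 k l.
    by rewrite kE lE /top_vector /u minor_xy.
  rewrite uE /act mxactE HE.
  have e1 : (1 : R[i]) != 0 by apply: oner_neq0.
  have xyI := @xi_neq_yi n; have sumE := @sum_shift n.
  split.
  - rewrite !BhomE (_ : - (l1 - 1) = (k + l)%N%:Z + 1); last by lia.
    rewrite p1 lE.
    exact: (bihom_decomposition R[i] xI yI xyI sumE).
  - exact: (irreducible_Hker_top xI yI xyI sumE
      nE pE hn e1).
  - apply: (top_vector_highest_weight xI yI xyI sumE nE pE hn e1) => h.
    by rewrite -mulNr -rmorphN opprD kE lE.
  - rewrite kE lE (@standard_productE _ _ _ _ 1 _ _ _ _ (@minor_xy R n)) //.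
    exact: (standard_poly_basis xI yI xyI sumE
      nE pE hn e1).
(* With the roles exchanged, the y-degree is $l_2=k+l$ and the x-degree is $-l_1=l$. *)
have [[k kE] [l lE]] : (exists k : nat, l1 + l2 = k) /\ (exists l : nat, - l1 = l).
  by split; [exists (absz (l1 + l2)) | exists (absz l1)]; lia.
have p2 : l2 = (k + l)%N%:Z by lia.
have HE : @Hhom' R n l1 l2 = Hker (@rshift n n) (@lshift n n) (k + l)%N%:Z l%:Z.
  by apply/funext => f; rewrite /Hhom' BhomE bihomC /Hker lE p2.
have uE : y (ord_n hn) ^+ absz (l1 + l2)%R * u ^+ absz l1 =
    top_vector (@rshift n n) (@lshift n n) (ord_n hn) (ord_n1 hn) (- 1) k l.
  by rewrite kE -(abszN l1) lE /top_vector /u minor_yx.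
rewrite uE /act mxactE gactC HE.
have e1 : (- 1 : R[i]) != 0 by rewrite oppr_eq0 oner_neq0.
have yxI := @yi_neq_xi n; have sumE := @sum_shift_swap n.
split.
- rewrite im_DeltaB; last by rewrite BhomE; apply: bihom_subspace.
  rewrite !BhomE !bihomC opprD lE p2.
  exact: (bihom_decomposition R[i] yI xI yxI sumE).
- exact: (irreducible_Hker_top yI xI yxI sumE
    nE pE hn e1).
- apply: (top_vector_highest_weight yI xI yxI sumE nE pE hn e1) => h.
  by rewrite lE kE.
- rewrite kE lE (@standard_productE _ _ _ _ (- 1) _ _ _ _ (@minor_yx R n)) //.
  exact: (standard_poly_basis yI xI yxI sumE
    nE pE hn e1).
Qed.
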